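(* Let $n\ge 3$ and $2\le m\le n-1$ be integers, let $Y\subset\mathbb P^n$ be a smooth hypersurface of degree $2m$, and let $\phi:X\to\mathbb P^n$ be a double cover branched along $Y$. Then for a general point $x\in X$, the variety of minimal rational tangents $\mathcal C_x\subset\mathbb P T_x(X)$ is a smooth complete intersection of multi-degree $(m+1,m+2,\ldots,2m)$.
   Context: Everything is over $\mathbb C$. A double cover $\phi:X\to\mathbb P^n$ branched along a smooth hypersurface $Y=\{F=0\}$ of degree $2m$ is a degree-2 finite morphism from a smooth projective variety with branch divisor $Y$; it is realized as the submanifold $\{s^2=F\}$ of the total space of the line bundle $\mathcal O_{\mathbb P^n}(m)$. A rational curve $C\subset X$ with $\phi(C)\not\subset Y$ is a minimal rational curve if it has degree $1$ with respect to $\phi^*\mathcal O_{\mathbb P^n}(1)$. For $x\in X\setminus\phi^{-1}(Y)$, $\mathcal K_x$ denotes the (normalized) space of minimal rational curves through $x$; minimal rational curves are smooth. $\mathbb P T_x(X)$ is the projective space of lines in $T_x(X)$, and the variety of minimal rational tangents (VMRT) $\mathcal C_x\subset\mathbb P T_x(X)$ is the union of the tangent directions at $x$ of the members of $\mathcal K_x$. ''General point'' means a point of a suitable dense Zariski open subset. *)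

(* Defs.v *)
From mathcomp Require Import all_boot all_order all_algebra.
From mathcomp Require Import reals.
From mathcomp Require Export complex.
From mathcomp Require Export mpoly.

Set Implicit Arguments.
Unset Strict Implicit.
Unset Printing Implicit Defensive.

Import GRing.Theory.
Local Open Scope ring_scope.

Definition ev (K : fieldType) (N : nat) (p : {mpoly K[N]}) (v : 'rV[K]_N) : K :=
  p.@[fun i => v 0 i].

Definition dev (K : fieldType) (N : nat) (p : {mpoly K[N]})
    (v w : 'rV[K]_N) : K :=
  \sum_(i < N) ev (p^`M(i)) v * w 0 i.

Definition smooth_hypersurface (K : fieldType) (N d : nat)
    (F : {mpoly K[N]}) : Prop :=
  [/\ F != 0, F \is d.-homog &
      forall v : 'rV[K]_N, v != 0 -> ev F v = 0 -> exists i, ev (F^`M(i)) v != 0].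

(* The scheme cut out in P^(N-1) by c forms is smooth of codimension c exactly
   when the Jacobian matrix of the forms has rank c at each of its points; such
   a scheme is reduced, hence determined by its set of points [Z], given here
   by its nonzero representatives. *)
Definition smooth_complete_intersection (K : fieldType) (N : nat)
    (d : seq nat) (Z : 'rV[K]_N -> Prop) : Prop :=
  exists f : 'I_(size d) -> {mpoly K[N]},
    [/\ forall i, f i \is (nth 0%N d i).-homog,
        forall v, v != 0 -> (Z v <-> forall i, ev (f i) v = 0) &
        forall v, v != 0 -> Z v ->
          row_free (\matrix_(i < size d, j < N) ev ((f i)^`M(j)) v)].

(* A point of the total space of O(m) over P^n is the class of a pair (x, s),
   with x != 0, modulo (x, s) ~ (a x, a^m s); we work with representatives. *)
Notation tot_rep K n := ('rV[K]_n.+1 * K^o)%type (only parsing).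

Definition same_point (K : fieldType) (n m : nat) (x y : tot_rep K n) : Prop :=
  exists2 a : K, a != 0 & y = (a *: x.1, a ^+ m * x.2).

Definition on_cover (K : fieldType) (n : nat) (F : {mpoly K[n.+1]})
    (x : tot_rep K n) : Prop :=
  x.1 != 0 /\ x.2 ^+ 2 = ev F x.1.

Definition over_branch (K : fieldType) (n : nat) (F : {mpoly K[n.+1]})
    (x : tot_rep K n) : Prop :=
  ev F x.1 = 0.

(* Polynomials in the fibre coordinate s with coefficients in K[x_0, ..., x_n],
   homogeneous of degree k when each x_i has weight 1 and s has weight m. *)
Definition whomog (K : fieldType) (n m k : nat)
    (H : {poly {mpoly K[n.+1]}}) : Prop :=
  forall j, if (j * m <= k)%N then H`_j \is (k - j * m).-homog else H`_j == 0.

Definition wev (K : fieldType) (n : nat) (H : {poly {mpoly K[n.+1]}})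
    (x : tot_rep K n) : K :=
  \sum_(j < size H) ev H`_j x.1 * x.2 ^+ j.

Definition zariski_open (K : fieldType) (n m : nat) (F : {mpoly K[n.+1]})
    (U : tot_rep K n -> Prop) : Prop :=
  exists S : {poly {mpoly K[n.+1]}} -> Prop,
    (forall H, S H -> exists k, whomog m k H) /\
    (forall x, on_cover F x -> (U x <-> exists2 H, S H & wev H x != 0)).

Definition zariski_dense (K : fieldType) (n m : nat) (F : {mpoly K[n.+1]})
    (U : tot_rep K n -> Prop) : Prop :=
  forall V : tot_rep K n -> Prop, zariski_open m F V ->
    (exists2 x, on_cover F x & V x) -> exists x, [/\ on_cover F x, V x & U x].

Definition for_general_point (K : fieldType) (n m : nat) (F : {mpoly K[n.+1]})
    (P : tot_rep K n -> Prop) : Prop :=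
  exists U : tot_rep K n -> Prop,
    [/\ zariski_open m F U, zariski_dense m F U &
        forall x, on_cover F x -> U x -> P x].

(* With x a representative of a point of X, the tangent space T_x(X) is the
   quotient of the tangent space at x of the cone {s^2 = F} by the line spanned
   by the Euler vector, tangent to the orbit t |-> (t x, t^m s). *)
Definition cone_tangent (K : fieldType) (n : nat) (F : {mpoly K[n.+1]})
    (x tau : tot_rep K n) : Prop :=
  2%:R * x.2 * tau.2 = dev F x.1 tau.1.

Definition euler (K : fieldType) (n m : nat) (x : tot_rep K n) : tot_rep K n :=
  (x.1, m%:R * x.2).

Definition zero_tangent (K : fieldType) (n m : nat)
    (x tau : tot_rep K n) : Prop :=
  exists a : K, tau = a *: euler m x.

(* [chi] induces a linear isomorphism from T_x(X) onto K^n. *)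
Definition tangent_coordinates (K : fieldType) (n m : nat)
    (F : {mpoly K[n.+1]}) (x : tot_rep K n)
    (chi : {linear tot_rep K n -> 'rV[K]_n}) : Prop :=
  (forall tau, cone_tangent F x tau -> (chi tau = 0 <-> zero_tangent m x tau)) /\
  (forall w, exists2 tau, cone_tangent F x tau & chi tau = w).

Definition lift (K : fieldType) (n : nat) (L : n.+1.-tuple {mpoly K[2]})
    (G : {mpoly K[2]}) (t : 'rV[K]_2) : tot_rep K n :=
  (\row_j ev (tnth L j) t, ev G t).

Definition dlift (K : fieldType) (n : nat) (L : n.+1.-tuple {mpoly K[2]})
    (G : {mpoly K[2]}) (t u : 'rV[K]_2) : tot_rep K n :=
  (\row_j dev (tnth L j) t u, dev G t u).

(* A rational curve C in X, given by its normalization nu : P^1 -> X.  If the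
   pull-back of phi^* O(1) under nu is O(d), then nu is given by n+1 forms of
   degree d without common zero and, for the coordinate s, by a section of the
   pull-back O(m d) of O(m); since nu is birational onto C, the degree of C with
   respect to phi^* O(1) is d. *)
Record rational_curve (K : fieldType) (n m : nat) (F : {mpoly K[n.+1]}) :=
  RationalCurve {
    rc_deg : nat;
    rc_base : n.+1.-tuple {mpoly K[2]};
    rc_fibre : {mpoly K[2]};
    rc_base_homog : forall j, tnth rc_base j \is rc_deg.-homog;
    rc_fibre_homog : rc_fibre \is (m * rc_deg).-homog;
    rc_no_base_point : forall t : 'rV[K]_2, t != 0 ->
      exists j, ev (tnth rc_base j) t != 0;
    rc_on_cover : rc_fibre ^+ 2 = F \mPo rc_base;
    rc_birational : exists (e : nat) (h : {mpoly K[2]}),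
      [/\ h != 0, h \is e.-homog &
          forall t t' : 'rV[K]_2, ev h t != 0 -> ev h t' != 0 ->
            t != 0 -> t' != 0 ->
            same_point m (lift rc_base rc_fibre t) (lift rc_base rc_fibre t') ->
            exists2 a : K, a != 0 & t' = a *: t]
  }.

Definition minimal_rational_curve (K : fieldType) (n m : nat)
    (F : {mpoly K[n.+1]}) (c : rational_curve m F) : Prop :=
  F \mPo rc_base c != 0 /\ rc_deg c = 1%N.

(* A point of P^1 sent to the class of x by a curve of degree 1 has a (unique)
   representative t lifting to x itself, so that tangent vectors at the point
   are the [dlift t u] modulo the Euler vector. *)
Definition vmrt (K : fieldType) (n m : nat) (F : {mpoly K[n.+1]})
    (x tau : tot_rep K n) : Prop :=
  ~ zero_tangent m x tau /\
  exists c : rational_curve m F, minimal_rational_curve c /\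
  exists t u : 'rV[K]_2,
    [/\ t != 0, lift (rc_base c) (rc_fibre c) t = x &
        tau = dlift (rc_base c) (rc_fibre c) t u].

(* Main.v *)
From HB Require Import structures.
Require Import Defs.
From mathcomp Require Import all_boot all_order all_algebra.
From mathcomp Require Import ring_quotient.
From mathcomp Require Import reals complex mpoly.
From mathcomp Require Import boolp classical_sets functions filter.
From mathcomp Require Import ring zify.

Set Implicit Arguments.
Unset Strict Implicit.
Unset Printing Implicit Defensive.

Import GRing.Theory.
Local Open Scope ring_scope.

(** Let [x = (p, s)] be a point of the cover with [s != 0].  A line through [p] is
    [y |-> y p + v], with [v] in a hyperplane not containing [p], and it lifts to a
    curve of degree 1 through [x] exactly when [F (y p + v)] is the square of a
    polynomial in [y] with leading term [s y^m].  Extracting the square root from the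
    top writes [F (y p + v) = B^2 + R], where [R] has degree less than [m] in [y] and
    its coefficient of [y^(m - 1 - i)] is a form of degree [m + 1 + i] in [v]
    ([hyper_line_sqrt]); a root with the prescribed leading term is unique, so the
    line lifts if and only if these [m] forms vanish at [v] ([sqrt_unique],
    [curve_of_section], [section_of_curve]).  This already gives equations of degrees
    [m + 1, ..., 2 m]; what remains is that their Jacobian has rank [m] at a general
    point.

    The lift of a line is called free here when its first-order deformations move
    the point over [p] in every direction ([free_at]).  If the line lifts, then
    modulo [B] the derivatives of [R] with respect to [v] are the restrictions to
    the line of the derivatives of [F].  Freeness says that the space these
    restrictions span in [K[y]/(B)] is stable under multiplication by [y], so that it
    is an ideal.  It is the whole ring: a common zero of [B] and of all the
    derivatives of [F] would be a singular point of the branch hypersurface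
    ([dline_generate]).  As [K[y]/(B)] has dimension [m], the Jacobian has rank [m]
    ([jacobian_onto]).

    Over a general [p] every lifted line is free.  This is generic smoothness in
    characteristic zero ([generic_tangent]), proved as follows.  Suppose that
    points with a non-free line are not contained in a hypersurface, and choose such
    a line over each of them.  In an ultrapower of [K] along an ultrafilter that
    contains the set of these points and no hypersurface, the tautological point is
    generic, that is, its coordinates are algebraically independent over [K]
    ([generic_field]), and the chosen lines form one lifted line through it.  A derivation of the subring generated by the coordinates of the
    generic point extends to any further elements ([derivation_extends]); applied to
    the equation of the lifted line it yields a deformation over the ultrapower,
    hence over some of the points, which is a contradiction.  The exceptional set is a
    cone, so it lies in a homogeneous hypersurface [D = 0] ([generic_free]), and the
    open set [D != 0] is dense in the cover ([pullback_dense]). *)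

(** * Ultrapowers of a field *)

Section Ultrapower.
Variables (T : pointedType) (K : fieldType) (U : set_system T).
Hypothesis ultraU : UltraFilter U.

Definition null_fun : {pred T -> K} := fun f => `[< U [set t | f t = 0]%classic >].

Lemma null_funP f : reflect (U [set t | f t = 0]%classic) (f \in null_fun).
Proof. exact: asboolP. Qed.

Lemma null_fun_idealr : idealr_closed null_fun.
Proof.
split.
- apply/null_funP; apply: filterS filterT => t _ //.
- apply/null_funP => U0.
  have [t /= /eqP] := filter_ex U0.
  by rewrite oner_eq0.
- move=> a f g /null_funP Uf /null_funP Ug; apply/null_funP.
  apply: filterS2 Uf Ug => t /= ft gt.
  by rewrite /GRing.add /= /GRing.mul /= ft gt mulr0 addr0.
Qed.
HB.instance Definition _ := isIdealr.Build _ null_fun null_fun_idealr.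

Definition ultrapower := {ideal_quot null_fun}.
HB.instance Definition _ := GRing.ComNzRing.on ultrapower.

Local Notation cls := (\pi_ultrapower%qT).

Lemma ultrapower_eq0 f : (cls f == 0) = (f \in null_fun).
Proof.
by have := Quotient.idealrBE null_fun f 0; rewrite subr0 rmorph0 => ->.
Qed.

Definition ultrapower_inv (x : ultrapower) : ultrapower :=
  cls (fun t => (repr x t)^-1).

Lemma ultrapower_mulVf (x : ultrapower) : x != 0 -> ultrapower_inv x * x = 1.
Proof.
move=> x0.
have -> : ultrapower_inv x * x = cls ((fun t => (repr x t)^-1) * repr x).
  by rewrite rmorphM /= reprK.
rewrite -(rmorph1 cls); apply/eqP; rewrite -subr_eq0 -rmorphB.
rewrite ultrapower_eq0; apply/null_funP.
have [U0|] := in_ultra_setVsetC [set t | repr x t = 0]%classic ultraU.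
  by move: x0; rewrite -[x]reprK ultrapower_eq0 => /null_funP.
apply: filterS => t /= /eqP xt0; apply/eqP; rewrite subr_eq0; apply/eqP.
exact: mulVf.
Qed.

Lemma ultrapower_inv0 : ultrapower_inv 0 = 0.
Proof.
apply/eqP; rewrite ultrapower_eq0; apply/null_funP.
have /null_funP : repr (0 : ultrapower) \in null_fun.
  by rewrite -ultrapower_eq0 reprK.
by apply: filterS => t /= ->; rewrite invr0.
Qed.

HB.instance Definition _ :=
  GRing.ComNzRing_isField.Build ultrapower ultrapower_mulVf ultrapower_inv0.

Lemma ultrapower_field : exists (L : fieldType) (pi : {rmorphism (T -> K) -> L}),
  (forall x, exists f, pi f = x) /\
  (forall f, pi f = 0 <-> U [set t | f t = 0]%classic).
Proof.
exists ultrapower, cls; split=> [x|f]; first by exists (repr x); rewrite /= reprK.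
split=> [/eqP|Uf]; first by rewrite ultrapower_eq0 => /null_funP.
by apply/eqP; rewrite ultrapower_eq0; apply/null_funP.
Qed.

End Ultrapower.

(** [L] consists of the functions on [T] modulo equality on the members of a filter
    [U] finer than [F]; what holds in [L] therefore holds somewhere on each member of
    [F]. *)
Lemma generic_field (T : pointedType) (K : fieldType) (F : set_system T) :
  ProperFilter F -> exists (U : set_system T) (L : fieldType)
    (pi : {rmorphism (T -> K) -> L}),
  [/\ ProperFilter U, (F `<=` U)%classic, forall x, exists f, pi f = x &
      forall f, pi f = 0 <-> U [set t | f t = 0]%classic].
Proof.
move=> PF; have [U [ultraU FU]] := ultraFilterLemma PF.
have [L [pi [surj_pi pi0]]] := ultrapower_field K ultraU.
exists U, L, pi; split=> //; exact: ultra_proper.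
Qed.

(** * Extension of derivations in characteristic zero *)

Definition derivation_along (A B : comNzRingType) (phi psi : A -> B) :=
  {morph psi : a b / a + b} /\
  forall a b, psi (a * b) = phi a * psi b + phi b * psi a.

Section MapDerivation.
Variables (A B : comNzRingType) (phi : {rmorphism A -> B}) (psi : A -> B).
Hypothesis der : derivation_along phi psi.

Lemma der0 : psi 0 = 0.
Proof.
case: der => + _ => /(_ 0 0)/eqP.
by rewrite addr0 -subr_eq0 opprD addNKr oppr_eq0 => /eqP.
Qed.

Lemma map_derD : {morph map_poly psi : p q / p + q}.
Proof.
move=> p q; apply/polyP => i.
by rewrite !(coefD, coef_map_id0 _ _ der0) (proj1 der).
Qed.

Lemma map_derM p q : map_poly psi (p * q) =
  map_poly phi p * map_poly psi q + map_poly phi q * map_poly psi p.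
Proof.
case: (der) => psiD psiM; apply/polyP => i.
rewrite coefD [in X in _ + X]mulrC !(coefM, coef_map_id0 _ _ der0).
rewrite (big_morph psi psiD der0) -big_split; apply: eq_bigr => j _ /=.
by rewrite !(coef_map, coef_map_id0 _ _ der0) psiM; congr (_ + _); exact: mulrC.
Qed.

Lemma map_derC a : map_poly psi a%:P = (psi a)%:P.
Proof.
apply/polyP => i; rewrite (coef_map_id0 _ _ der0) !coefC.
by case: eqP => // _; exact: der0.
Qed.

End MapDerivation.

Section Derivation.
Variables (A : comNzRingType) (L : fieldType).
Hypothesis char0 : forall n, n.+1%:R != 0 :> L.

Variables (phi : {rmorphism A -> L}) (psi : A -> L).
Hypothesis der : derivation_along phi psi.
Hypothesis ker : forall a, phi a = 0 -> psi a = 0.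
Variable x : L.

Definition horner_phi (p : {poly A}) : L := (map_poly phi p).[x].

Lemma horner_phi_is_additive : zmod_morphism horner_phi.
Proof. by move=> p q; rewrite /horner_phi rmorphB hornerD hornerN. Qed.
Lemma horner_phi_is_multiplicative : monoid_morphism horner_phi.
Proof.
by split=> [|p q]; rewrite /horner_phi ?rmorph1 ?hornerC // rmorphM hornerM.
Qed.
HB.instance Definition _ :=
  GRing.isZmodMorphism.Build _ _ horner_phi horner_phi_is_additive.
HB.instance Definition _ :=
  GRing.isMonoidMorphism.Build _ _ horner_phi horner_phi_is_multiplicative.

(** The extension of [psi] to polynomials, evaluated at [x], that takes the value [u]
    at the variable. *)
Definition horner_psi u (p : {poly A}) : L :=
  (map_poly psi p).[x] + u * (map_poly phi p)^`().[x].

Lemma horner_psiD u : {morph horner_psi u : p q / p + q}.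
Proof.
move=> p q; rewrite /horner_psi (map_derD der) rmorphD derivD !hornerD mulrDr.
by rewrite addrACA.
Qed.

Lemma horner_psiM u p q : horner_psi u (p * q) =
  horner_phi p * horner_psi u q + horner_phi q * horner_psi u p.
Proof.
rewrite /horner_psi (map_derM der) rmorphM derivM !hornerD !hornerM /horner_phi.
ring.
Qed.

Lemma horner_psiC u a : horner_psi u a%:P = psi a.
Proof.
by rewrite /horner_psi map_polyC /= derivC horner0 mulr0 addr0 (map_derC der) hornerC.
Qed.

Lemma horner_psi_map0 u p : map_poly phi p = 0 -> horner_psi u p = 0.
Proof.
move=> p0; rewrite /horner_psi p0 deriv0 horner0 mulr0 addr0.
suff -> : map_poly psi p = 0 by rewrite horner0.
apply/polyP => i; rewrite (coef_map_id0 _ _ (der0 der)) coef0 ker //.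
by rewrite -coef_map p0 coef0.
Qed.

(** If [x] is transcendental over the image of [phi], any value [u] of the derivation
    at [x] will do.  Otherwise let [h] be an equation of [x] of least degree; in
    characteristic zero [h'] does not vanish at [x], so there is a [u] for which the
    derivation kills [h].  Any other equation of [x] is reduced to zero by
    multiples of [h], up to multiplication by the leading coefficient of [h]. *)
Lemma derivation_extends : exists u, derivation_along horner_phi (horner_psi u) /\
  forall p, horner_phi p = 0 -> horner_psi u p = 0.
Proof.
suff [u Hu] : exists u, forall p, horner_phi p = 0 -> horner_psi u p = 0.
  by exists u; split=> //; split; [exact: horner_psiD | exact: horner_psiM].
have [[h hx h0]|alg] := pselect (exists2 h, horner_phi h = 0 & map_poly phi h != 0);
  last first.
  exists 0 => p px; apply: horner_psi_map0; apply/eqP/negP => p0.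
  by apply: alg; exists p => //; apply/negP.
have exd : exists d, `[< exists h, [/\ horner_phi h = 0, map_poly phi h != 0 &
    size (map_poly phi h) = d] >].
  by exists (size (map_poly phi h)); apply/asboolP; exists h.
case: (ex_minnP exd) => d /asboolP [{h0}h [{}hx h0 hd]] mind.
have {mind} mind p : horner_phi p = 0 -> (size (map_poly phi p) < d)%N ->
    map_poly phi p = 0.
  move=> px pd; apply/eqP/negPn/negP => p0.
  move: pd; rewrite ltnNge mind //; apply/asboolP; by exists p.
have d1 : (1 < d)%N.
  rewrite -hd ltnNge; apply/negP => /size1_polyC hC.
  move: hx h0; rewrite /horner_phi hC hornerC => ->; by rewrite eqxx.
have dh0 : horner_phi h^`() != 0.
  apply/negP => /eqP dhx.
  have /(congr1 (fun p : {poly L} => p`_d.-2)) : map_poly phi h^`() = 0.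
    by apply: mind => //; rewrite -deriv_map -hd lt_size_deriv.
  rewrite -deriv_map coef_deriv coef0 => /eqP.
  have -> : d.-2.+1 = d.-1 by case: (d) d1 => [|[]].
  rewrite -mulr_natr mulf_eq0 -hd -lead_coefE lead_coef_eq0 (negPf h0) /=.
  by rewrite hd; case: (d) d1 => [|[|e]] //= _; apply/negP/char0.
(* The value at [x] that makes the extended derivation vanish on [h]. *)
pose u := - (map_poly psi h).[x] / horner_phi h^`().
have hu : horner_psi u h = 0.
  rewrite /horner_psi deriv_map -/(horner_phi _) /u divfK //; exact: subrr.
exists u => p; have [N] := ubnP (size (map_poly phi p)).
elim: N p => // N IH p; rewrite ltnS => pN px.
have [p0|p0] := eqVneq (map_poly phi p) 0; first exact: horner_psi_map0.
have dp : (d <= size (map_poly phi p))%N.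
  by rewrite leqNgt; apply/negP => /(mind _ px) /eqP; rewrite (negPf p0).
set s := size (map_poly phi p) in pN dp.
(* One step of pseudo-division by [h]: [p1] has smaller degree than [p]. *)
pose a := h`_d.-1; pose b := p`_s.-1.
have a0 : phi a != 0 by rewrite -coef_map -hd -lead_coefE lead_coef_eq0.
pose q := b%:P * 'X^(s - d) * h.
pose p1 := a%:P * p - q.
have qx : horner_phi q = 0 by rewrite rmorphM /= hx mulr0.
have p1x : horner_phi p1 = 0 by rewrite rmorphB /= qx rmorphM /= px mulr0 subr0.
have s0 : (0 < s)%N by apply: leq_trans dp; exact: ltnW.
have p1s : (size (map_poly phi p1) < s)%N.
  rewrite -(prednK s0) ltnS; apply/leq_sizeP => i; rewrite leq_eqVlt.
  rewrite rmorphB /= !rmorphM /= !map_polyC map_polyXn /= coefB coefCM.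
  rewrite -mulrA coefCM coefXnM.
  case/orP => [/eqP <-|si].
    have -> : (s.-1 < s - d)%N = false.
      by apply/negbTE; rewrite -leqNgt; case: (s) (d) d1 => [|s'] [|d'] //= _;
         rewrite subSS leq_subr.
    have -> : (s.-1 - (s - d) = d.-1)%N.
      case: (s) (d) d1 dp => [|s'] [|d'] //= _.
      by rewrite ltnS subSS => /subKn.
    by rewrite !coef_map /= mulrC subrr.
  rewrite (prednK s0) in si; rewrite nth_default // mulr0 sub0r.
  rewrite [X in _ * X](_ : _ = 0) ?mulr0 ?oppr0 //; case: ifP => // _.
  rewrite nth_default // hd.
  by rewrite leq_subRL ?(leq_trans (leq_subr _ _) si) // subnK.
have: horner_psi u (a%:P * p) = 0.
  have -> : a%:P * p = p1 + q by rewrite subrK.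
  by rewrite horner_psiD IH ?(leq_trans p1s) // /q horner_psiM hx hu mulr0 mul0r !addr0.
rewrite horner_psiM px mul0r addr0 {1}/horner_phi map_polyC hornerC => /eqP.
by rewrite mulf_eq0 (negPf a0) => /eqP.
Qed.

End Derivation.

(** The derivation is not defined on a subring of [L] but on a ring [B] mapping to
    [L], obtained from [A] by adjoining one variable for each element of [ys]; the
    condition on kernels says that it factors through the image of [B]. *)
Lemma derivation_extends_seq (L : fieldType) (ys : seq L) (A : comNzRingType)
    (phi : {rmorphism A -> L}) (psi : A -> L) :
  (forall n, n.+1%:R != 0 :> L) ->
  derivation_along phi psi -> (forall a, phi a = 0 -> psi a = 0) ->
  exists (B : comNzRingType) (j : {rmorphism A -> B})
    (Phi : {rmorphism B -> L}) (Psi : B -> L),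
  [/\ derivation_along Phi Psi, forall b, Phi b = 0 -> Psi b = 0,
      forall a, Phi (j a) = phi a, forall a, Psi (j a) = psi a &
      forall y, y \in ys -> exists b, Phi b = y].
Proof.
move=> char0; elim: ys A phi psi => [|x ys IH] A phi psi der ker.
  by exists A, idfun, phi, psi; split.
have [u [der' ker']] := derivation_extends char0 der ker x.
have [B [j [Phi [Psi [derB kerB PhiE PsiE surj]]]]] :=
  IH _ _ _ der' ker'.
exists B, (j \o polyC), Phi, Psi; split=> // [a|a|y] /=.
- by rewrite PhiE /= /horner_phi map_polyC hornerC.
- by rewrite PsiE (horner_psiC der).
rewrite inE => /predU1P[->|/surj//].
by exists (j 'X); rewrite PhiE /= /horner_phi map_polyX hornerX.
Qed.

(** * Polynomial functions and their differentials *)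

Lemma mpoly_ring_ind (R : comNzRingType) n (P : {mpoly R[n]} -> Prop) :
  (forall c, P c%:MP) -> (forall i, P 'X_i) ->
  (forall p q, P p -> P q -> P (p + q)) ->
  (forall p q, P p -> P q -> P (p * q)) -> forall p, P p.
Proof.
move=> PC PX PD PM p; rewrite (mpolyE p).
elim/big_ind: _ => [|q r|m _]; [by rewrite -mpolyC0 | exact: PD |].
rewrite -mul_mpolyC; apply: (PM) => //; rewrite mpolyXE_id.
elim/big_ind: _ => [|q r|i _]; [by rewrite -mpolyC1 | exact: PM |].
by elim: (m i) => [|k IH]; rewrite ?expr0 -?mpolyC1 // exprS; exact: PM.
Qed.

Lemma mderivXU (R : comNzRingType) n (i j : 'I_n) :
  ('X_i : {mpoly R[n]})^`M(j) = (i == j)%:R.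
Proof.
rewrite mderivX mnm1E; case: eqP => [->|_]; last by rewrite scale0r.
by rewrite scale1r -[X in (X - _)%MM]add0m addmK mpolyX0.
Qed.

Lemma derivation_chain (R S : comNzRingType) n
    (phi : {rmorphism {mpoly R[n]} -> S}) (delta : {mpoly R[n]} -> S) :
  (forall c, delta c%:MP = 0) -> derivation_along phi delta ->
  forall p, delta p = \sum_i phi p^`M(i) * delta 'X_i.
Proof.
move=> dC [dD dM]; apply: mpoly_ring_ind => [c|i|p q IHp IHq|p q IHp IHq].
- by rewrite dC big1 // => i _; rewrite mderivC rmorph0 mul0r.
- rewrite (bigD1 i) //= mderivXU eqxx rmorph1 mul1r big1 ?addr0 // => k ki.
  by rewrite mderivXU eq_sym (negPf ki) mulr0n rmorph0 mul0r.
- rewrite dD IHp IHq -big_split; apply: eq_bigr => i _ /=.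
  by rewrite mderivD rmorphD mulrDl.
- rewrite dM IHp IHq !mulr_sumr -big_split; apply: eq_bigr => i _ /=.
  by rewrite mderivM rmorphD !rmorphM /=; ring.
Qed.

Section Ev.
Variables (K : fieldType) (N : nat).
Implicit Types (p q : {mpoly K[N]}) (v w : 'rV[K]_N).

Lemma evD p q v : ev (p + q) v = ev p v + ev q v. Proof. exact: rmorphD. Qed.
Lemma evB p q v : ev (p - q) v = ev p v - ev q v. Proof. exact: rmorphB. Qed.
Lemma evM p q v : ev (p * q) v = ev p v * ev q v. Proof. exact: rmorphM. Qed.
Lemma evC c v : ev (c%:MP : {mpoly K[N]}) v = c. Proof. exact: mevalC. Qed.
Lemma evX i v : ev ('X_i : {mpoly K[N]}) v = v 0 i. Proof. exact: mevalXU. Qed.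

Lemma devD p q v w : dev (p + q) v w = dev p v w + dev q v w.
Proof.
by rewrite /dev -big_split; apply: eq_bigr => i _; rewrite mderivD evD mulrDl.
Qed.
Lemma devM p q v w : dev (p * q) v w = ev p v * dev q v w + ev q v * dev p v w.
Proof.
rewrite /dev !mulr_sumr -big_split; apply: eq_bigr => i _ /=.
rewrite mderivM evD !evM; ring.
Qed.
Lemma devC c v w : dev (c%:MP : {mpoly K[N]}) v w = 0.
Proof. by rewrite /dev big1 // => i _; rewrite mderivC -mpolyC0 evC mul0r. Qed.
Lemma devX i v w : dev ('X_i : {mpoly K[N]}) v w = w 0 i.
Proof.
rewrite /dev (bigD1 i) //= mderivXU eqxx -mpolyC1 evC mul1r big1 ?addr0 //.
by move=> k ki; rewrite mderivXU eq_sym (negPf ki) mulr0n -mpolyC0 evC mul0r.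
Qed.

Definition evf p : 'rV[K]_N -> K := ev p.
Lemma evf_is_additive : zmod_morphism evf.
Proof. by move=> p q; apply: funext => v; exact: evB. Qed.
Lemma evf_is_multiplicative : monoid_morphism evf.
Proof.
split=> [|p q]; apply: funext => v; last exact: evM.
by rewrite /evf -mpolyC1 evC.
Qed.
HB.instance Definition _ := GRing.isZmodMorphism.Build _ _ evf evf_is_additive.
HB.instance Definition _ :=
  GRing.isMonoidMorphism.Build _ _ evf evf_is_multiplicative.
End Ev.

(** * Generic smoothness *)

(** An alias of the type of row vectors, to make it pointed: rings of functions have
    [1 != 0] only on an inhabited type. *)
Definition affine (K : fieldType) N := 'rV[K]_N.
HB.instance Definition _ (K : fieldType) N := Choice.on (affine K N).
HB.instance Definition _ (K : fieldType) N := isPointed.Build (affine K N) 0.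

(** Generic smoothness of the projection to the first [N] coordinates, for points
    [row_mx p (Y p)] of the zero locus of [fs] lying over a Zariski-dense set [S]:
    at one of these points some tangent vector to the zero locus lies over [e]. *)
Lemma generic_tangent (K : fieldType) (N r : nat)
    (fs : seq {mpoly K[N + r]}) (S : 'rV[K]_N -> Prop)
    (Y : 'rV[K]_N -> 'rV[K]_r) (e : 'rV[K]_N) :
  (forall n, n.+1%:R != 0 :> K) ->
  (forall p, S p -> forall f, f \in fs -> ev f (row_mx p (Y p)) = 0) ->
  (forall D : {mpoly K[N]}, D != 0 -> exists2 p, S p & ev D p != 0) ->
  exists2 p, S p & exists u, forall f, f \in fs ->
    dev f (row_mx p (Y p)) (row_mx e u) = 0.
Proof.
move=> char0 fsY denseS.
(* The members of [F] are the sets containing the points of [S] off a hypersurface. *)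
pose F : set_system (affine K N) := fun A =>
  exists2 D : {mpoly K[N]}, D != 0 & forall p, S p -> ev D p != 0 -> A p.
have FF : ProperFilter F.
  split; first by case=> D /denseS[p Sp Dp] /(_ _ Sp Dp).
  split; first by exists 1; rewrite ?oner_neq0.
    move=> A B [D D0 DA] [E E0 EB]; exists (D * E); first by rewrite mulf_neq0.
    by move=> p Sp; rewrite evM mulf_eq0 negb_or => /andP[/DA+ /EB]; split; auto.
  by move=> A B AB [D D0 DA]; exists D => // p Sp /DA/AB; exact.
have [U [L [pi [UF FU surj pi0]]]] :=
  generic_field (T := affine K N) K FF.
have inF (A : set (affine K N)) : (forall p, S p -> A p) -> U A.
  by move=> SA; apply: FU; exists 1; rewrite ?oner_neq0 // => p /SA.
have charL n : n.+1%:R != 0 :> L.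
  apply/eqP => n0.
  have : pi n.+1%:R = 0 by rewrite rmorph_nat.
  move/pi0 => /filter_ex[t /=] /eqP.
  suff -> : (n.+1%:R : affine K N -> K) t = n.+1%:R by rewrite (negPf (char0 n)).
  by elim: (n.+1) => // k IH; rewrite -addn1 !natrD -IH.
(* [phi] evaluates at the generic point, with coordinates in [L]; it is injective
   because no hypersurface belongs to [U]. *)
pose phi : {mpoly K[N]} -> L := pi \o (@evf K N).
pose psi (f : {mpoly K[N]}) : L := pi (fun t => dev f t e).
have phi_inj f : phi f = 0 -> f = 0.
  move/pi0 => Uf; apply/eqP/negPn/negP => f0.
  have : U [set t | ev f t != 0]%classic by apply: FU; exists f.
  by move=> /(filterI Uf)/filter_ex[t [/= ft]]; rewrite -/(evf f t) ft eqxx.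
have der : derivation_along phi psi.
  split=> a b.
  - rewrite -rmorphD; congr (pi _); apply: funext => t; exact: devD.
  - rewrite /psi /phi /= -!rmorphM -rmorphD; congr (pi _); apply: funext => t; exact: devM.
have ker0 a : phi a = 0 -> psi a = 0.
  move=> /phi_inj->; rewrite -(rmorph0 pi); congr (pi _); apply: funext => t.
  by rewrite -mpolyC0 devC.
pose y (l : 'I_r) : L := pi (fun t => Y t 0 l).
have [B [j [Phi [Psi [derB ker PhiE PsiE surjB]]]]] :=
  derivation_extends_seq (codom y) charL der ker0.
have /choice[b bE] l : exists c, Phi c = y l by apply/surjB/codom_f.
have /choice[u uE] l : exists c, pi c = Psi (b l) by exact: surj.
pose z (i : 'I_(N + r)) : B :=
  match fintype.split i with inl a => j 'X_a | inr l => b l end.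
(* Evaluation at the point of the zero locus over the generic point, lifted from [L]
   to [B]. *)
pose ext : {mpoly K[N + r]} -> B := mmap (j \o (@mpolyC N K)) z.
have extE f : Phi (ext f) = pi (fun t => ev f (row_mx t (Y t))).
  elim/mpoly_ring_ind: f => [c|i|p q IHp IHq|p q IHp IHq].
  - rewrite /ext mmapC /= PhiE /phi /=; congr (pi _); apply: funext => t.
    by rewrite /evf !evC.
  - rewrite /ext mmapX mmap1U /z; case: (split_ordP i) => k ->.
      rewrite PhiE /phi /=; congr (pi _); apply: funext => t.
      by rewrite /evf !evX row_mxEl.
    rewrite bE; congr (pi _); apply: funext => t.
    by rewrite evX row_mxEr.
  - rewrite /ext rmorphD rmorphD IHp IHq -rmorphD; congr (pi _).
    by apply: funext => t; rewrite evD.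
  - rewrite /ext rmorphM rmorphM IHp IHq -rmorphM; congr (pi _).
    by apply: funext => t; rewrite evM.
case: (derB) => PsiD PsiM.
pose du t : 'rV[K]_r := \row_l u l t.
have dextE f : Psi (ext f) =
    pi (fun t => dev f (row_mx t (Y t)) (row_mx e (du t))).
  rewrite -[LHS]/((Psi \o ext) f) (derivation_chain (phi := Phi \o ext)).
  - have -> : (fun t => dev f (row_mx t (Y t)) (row_mx e (du t))) =
      \sum_i ((fun t => ev f^`M(i) (row_mx t (Y t))) *
              (fun t => row_mx e (du t) 0 i)) :> (affine K N -> K).
      by apply: funext => t; rewrite fct_sumE.
    rewrite rmorph_sum; apply: eq_bigr => i _; rewrite rmorphM -extE /=.
    congr (_ * _); rewrite /ext mmapX mmap1U /z.
    case: (split_ordP i) => k ->.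
      rewrite PsiE; congr (pi _); apply: funext => t.
      by rewrite devX row_mxEl.
    rewrite -uE; congr (pi _); apply: funext => t.
    by rewrite row_mxEr mxE.
  - move=> c; rewrite /= /ext mmapC /= PsiE -(rmorph0 pi); congr (pi _).
    by apply: funext => t; rewrite devC.
  - by split=> p q; rewrite /= /ext ?rmorphD ?PsiD // rmorphM PsiM.
have Ufs (gs : seq {mpoly K[N + r]}) : {subset gs <= fs} -> U [set t | forall f, f \in gs ->
    dev f (row_mx t (Y t)) (row_mx e (du t)) = 0]%classic.
  elim: gs => [|g gs IH] sub; first by apply: inF.
  have gfs : g \in fs by apply: sub; rewrite mem_head.
  have Ug : U [set t | dev g (row_mx t (Y t)) (row_mx e (du t)) = 0]%classic.
    apply/pi0; rewrite -dextE; apply: ker; rewrite extE; apply/pi0/inF.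
    by move=> p Sp; exact: fsY.
  have /IH Ugs : {subset gs <= fs} by move=> f fg; apply: sub; rewrite inE fg orbT.
  apply: filterS2 Ug Ugs => t /= Ht Hts f; rewrite inE => /predU1P[->//|/Hts//].
have US : U [set t | S t]%classic by apply: inF.
have [t [/= St Ht]] := filter_ex (filterI US (Ufs fs (fun _ h => h))).
by exists t => //; exists (du t).
Qed.

(** * Restriction to lines and square roots *)

Section Graded.
Variables (R : comNzRingType) (n : nat).
Implicit Types (P Q : {poly {mpoly R[n]}}).

(** [P] is homogeneous of degree [d] when the main variable has weight 1, like the
    variables of the coefficients.  Stated with the degree of each coefficient
    quantified, it needs no subtraction. *)
Definition bihomog d P := forall k, exists2 e, P`_k \is e.-homog &
  P`_k != 0 -> (e + k = d)%N.

Lemma bihomogP d P : bihomog d P <->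
  forall k, if (k <= d)%N then P`_k \is (d - k).-homog else P`_k == 0.
Proof.
split=> H k; have := H k.
  case=> e he; have [->|nz] := eqVneq P`_k 0; first by rewrite dhomog0 ?eqxx; case: ifP.
  by move=> /(_ isT) <-; rewrite leq_addl addnK.
case: ifP => [kd Pk|_ /eqP->]; last by exists 0%N; rewrite ?dhomog0 ?eqxx.
by exists (d - k)%N => // _; rewrite subnK.
Qed.

Lemma bihomogC d (c : {mpoly R[n]}) : c \is d.-homog -> bihomog d c%:P.
Proof.
move=> cd k; rewrite coefC; case: eqP => [->|_].
  by exists d => //; rewrite addn0.
by exists 0%N; rewrite ?dhomog0 ?eqxx.
Qed.

Lemma bihomogX : bihomog 1 'X.
Proof.
move=> k; rewrite coefX; case: eqP => [->|_].
  by exists 0%N => //; rewrite dhomog1.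
by exists 0%N; rewrite ?dhomog0 ?eqxx.
Qed.

Lemma bihomogD d P Q : bihomog d P -> bihomog d Q -> bihomog d (P + Q).
Proof.
move=> /bihomogP hP /bihomogP hQ; apply/bihomogP => k.
have := hP k; have := hQ k; rewrite coefD; case: ifP => _ hq hp.
  exact: dhomogD.
by rewrite (eqP hp) (eqP hq) addr0.
Qed.

Lemma bihomogN d P : bihomog d P -> bihomog d (- P).
Proof.
move=> /bihomogP hP; apply/bihomogP => k.
have := hP k; rewrite coefN; case: ifP => _ hp; first by rewrite dhomogN.
by rewrite (eqP hp) oppr0.
Qed.

Lemma bihomog_sum d (I : Type) (r : seq I) (p : pred I) (G : I -> {poly {mpoly R[n]}}) :
  (forall i, p i -> bihomog d (G i)) -> bihomog d (\sum_(i <- r | p i) G i).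
Proof.
move=> hG; elim/big_ind: _ => //; last exact: bihomogD.
by move=> k; rewrite coef0; exists 0%N; rewrite ?dhomog0 ?eqxx.
Qed.

Lemma bihomogM d e P Q : bihomog d P -> bihomog e Q -> bihomog (d + e) (P * Q).
Proof.
move=> /bihomogP hP /bihomogP hQ; apply/bihomogP => k; rewrite coefM.
have term (j : 'I_k.+1) : P`_j * Q`_(k - j) = 0 \/
    [/\ (j <= d)%N, (k - j <= e)%N &
      P`_j * Q`_(k - j) \is ((d - j) + (e - (k - j))).-homog].
  have := hP j; have := hQ (k - j)%N.
  case: ifP => [ke hq|_ /eqP->]; last by left; rewrite mulr0.
  case: ifP => [jd hp|_ /eqP->]; last by left; rewrite mul0r.
  by right; split=> //; exact: dhomogM.
case: ifP => kde.
  apply: rpred_sum => j _; case: (term j) => [->|[jd kj]]; first exact: dhomog0.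
  have jk : (j <= k)%N by rewrite -ltnS.
  by have -> : (d + e - k = d - j + (e - (k - j)))%N by lia.
rewrite big1 // => j _; case: (term j) => // -[jd kj _].
have jk : (j <= k)%N by rewrite -ltnS.
by lia.
Qed.

Lemma bihomogXn d P k : bihomog d P -> bihomog (d * k) (P ^+ k).
Proof.
move=> hP; elim: k => [|k IH]; last by rewrite exprS mulnS; exact: bihomogM.
by rewrite expr0 muln0; apply: bihomogC; rewrite dhomog1.
Qed.

End Graded.

Section Line.
Variables (K : fieldType) (S : comNzRingType) (iota : {rmorphism K -> S}).
Variable N : nat.

(** The restriction of a polynomial to the line [y |-> y p + v], as a polynomial
    in [y]; [p] and [v] may have their coordinates in an extension of [K]. *)
Definition line (p v : 'I_N -> S) : {mpoly K[N]} -> {poly S} :=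
  mmap (polyC \o iota) (fun i => (p i)%:P * 'X + (v i)%:P).
HB.instance Definition _ p v := GRing.RMorphism.on (line p v).

Lemma lineC p v c : line p v c%:MP = (iota c)%:P. Proof. exact: mmapC. Qed.
Lemma lineX p v i : line p v 'X_i = (p i)%:P * 'X + (v i)%:P.
Proof. by rewrite /line mmapX mmap1U. Qed.
End Line.

Lemma bihomog_line (K : fieldType) (N n d : nat) (F : {mpoly K[N]})
    (p v : 'I_N -> {mpoly K[n]}) :
  F \is d.-homog -> (forall i, p i \is 0.-homog) -> (forall i, v i \is 1.-homog) ->
  bihomog d (line (@mpolyC n K) p v F).
Proof.
move=> /dhomogP hF hp hv; rewrite /line /mmap big_seq.
apply: bihomog_sum => m /hF mE; have <- : mdeg m = d by [].
rewrite -[mdeg m]add0n; apply: bihomogM.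
  by apply: bihomogC; rewrite dhomogE msuppC; case: ifP => //= _; rewrite mdeg0.
rewrite mdegE /mmap1; elim/big_rec2: _ => [|i d' P _ IH].
  by apply: bihomogC; rewrite dhomog1.
apply: bihomogM => //; rewrite -[X in bihomog X _]mul1n; apply: bihomogXn.
by apply: bihomogD; [rewrite -[1%N]add0n; apply: bihomogM (bihomogC _) (bihomogX _ _)
  | apply: bihomogC].
Qed.

Lemma map_line (K : fieldType) (S S' : comNzRingType) (iota : {rmorphism K -> S})
    (iota' : {rmorphism K -> S'}) (phi : {rmorphism S -> S'}) N (p v : 'I_N -> S) f :
  (forall c, phi (iota c) = iota' c) ->
  map_poly phi (line iota p v f) = line iota' (phi \o p) (phi \o v) f.
Proof.
move=> phiE; elim/mpoly_ring_ind: f => [c|i|f g IHf IHg|f g IHf IHg].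
- by rewrite !lineC map_polyC /= phiE.
- by rewrite !lineX rmorphD rmorphM /= !map_polyC map_polyX.
- by rewrite !rmorphD /= IHf IHg.
- by rewrite !rmorphM /= IHf IHg.
Qed.

(** Square roots are extracted degree by degree from the top: the leading
    coefficient [s] is invertible, and each further coefficient of the root is
    forced by one coefficient of [P]. *)
Lemma truncated_sqrt (K : fieldType) (n m : nat) (s : K) (P : {poly {mpoly K[n]}}) :
  2%:R != 0 :> K -> s != 0 -> bihomog (2 * m) P -> P`_(2 * m) = (s ^+ 2)%:MP ->
  exists B, [/\ bihomog m B, B`_m = s%:MP & (size (P - B ^+ 2)%R <= m)%N].
Proof.
move=> two0 s0 hP Ptop.
suff H j : (j <= m)%N -> exists B, [/\ bihomog m B, B`_m = s%:MP &
    forall k, (2 * m - j <= k)%N -> (P - B ^+ 2)`_k = 0].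
  have [B [hB Bm PB]] := H m (leqnn m); exists B; split=> //.
  by apply/leq_sizeP => k mk; apply: PB; rewrite mul2n -addnn addnK.
have coef_big d (Q : {poly {mpoly K[n]}}) k : bihomog d Q -> (d < k)%N -> Q`_k = 0.
  by move=> /bihomogP/(_ k); rewrite leqNgt => + dk; rewrite dk => /eqP.
elim: j => [_|j IH jm].
  pose B : {poly {mpoly K[n]}} := (s%:MP)%:P * 'X^m.
  have hB : bihomog m B.
    rewrite -[X in bihomog X _]add0n -{1}[m]mul1n; apply: bihomogM.
      by apply: bihomogC; rewrite dhomogE msuppC; case: ifP => //= _; rewrite mdeg0.
    exact/bihomogXn/bihomogX.
  have hPB : bihomog (2 * m) (P - B ^+ 2).
    by apply: bihomogD => //; apply: bihomogN; rewrite mulnC; exact: bihomogXn.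
  exists B; split=> //; first by rewrite coefCM coefXn eqxx mulr1.
  move=> k; rewrite subn0 leq_eqVlt => /predU1P[<-|]; last exact: coef_big.
  rewrite coefB Ptop rmorphXn /= exprMn -polyC_exp coefCM -exprM mulnC coefXn eqxx.
  by rewrite mulr1 subrr.
have {IH} [B [hB Bm PB]] := IH (ltnW jm).
have hPB : bihomog (2 * m) (P - B ^+ 2).
  by apply: bihomogD => //; apply: bihomogN; rewrite mulnC; exact: bihomogXn.
set k0 := (2 * m - j.+1)%N; pose e := (m - j.+1)%N.
pose c := (2%:R * s)^-1 *: (P - B ^+ 2)`_k0.
have hc : c \is j.+1.-homog.
  have := (bihomogP _ _).1 hPB k0; rewrite leq_subr subKn; last by lia.
  by move=> h; apply: dhomogZ.
pose C := c%:P * 'X^e.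
have hC : bihomog m C.
  have -> : m = (j.+1 + 1 * e)%N by rewrite mul1n /e subnKC.
  by apply: bihomogM; [apply: bihomogC | apply/bihomogXn/bihomogX].
exists (B + C); split; first exact: bihomogD.
  rewrite coefD Bm coefCM coefXn; case: eqP; last by rewrite mulr0 addr0.
  by rewrite /e; lia.
move=> k k0k.
have -> : P - (B + C) ^+ 2 = (P - B ^+ 2) - (2%:R * B * C + C ^+ 2) by ring.
rewrite coefB [X in _ - X]coefD.
have -> : (C ^+ 2)`_k = 0.
  rewrite exprMn -polyC_exp coefCM -exprM coefXn; case: eqP; rewrite ?mulr0 //.
  by rewrite /e /k0; lia.
rewrite addr0 -mulrA mulr_natl coefMn mulrCA coefCM coefMXn.
have -> : (k < e)%N = false by rewrite /e; lia.
move: k0k; rewrite leq_eqVlt => /predU1P[<-|k0k].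
  have -> : (k0 - e = m)%N by rewrite /k0 /e; lia.
  rewrite Bm [c * _]mulrC mul_mpolyC scalerA mulrC -scaler_nat scalerA.
  by rewrite mulrCA mulVf ?mulf_neq0 // scale1r subrr.
rewrite PB; last by rewrite /k0; lia.
rewrite (coef_big m B _ hB) ?mulr0 ?mul0rn ?subr0 //.
by rewrite /e; lia.
Qed.

Section TopCoef.
Variable S : nzRingType.

Definition top_coef d (P : {poly S}) (a : S) := (size P <= d.+1)%N /\ P`_d = a.

Lemma top_coefM d e (P Q : {poly S}) a b :
  top_coef d P a -> top_coef e Q b -> top_coef (d + e) (P * Q) (a * b).
Proof.
case=> sP Pd [sQ Qe]; split.
  apply: leq_trans (size_polyMleq _ _) _.
  by rewrite -subn1 leq_subLR add1n -addSn -addnS leq_add.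
have dle : (d < (d + e).+1)%N by rewrite ltnS leq_addr.
rewrite coefM (bigD1 (Ordinal dle)) //= addKn Pd Qe big1 ?addr0 // => j jd.
have [dj|jd'] := ltnP d j; first by rewrite nth_default ?mul0r ?(leq_trans sP).
have {jd'} jd' : (j < d)%N.
  by rewrite ltn_neqAle jd' andbT; apply: contra jd => /eqP E; apply/eqP/val_inj.
by rewrite [Q`__]nth_default ?mulr0 //; apply: leq_trans sQ _; lia.
Qed.

Lemma top_coefX d (P : {poly S}) a k : top_coef d P a -> top_coef (d * k) (P ^+ k) (a ^+ k).
Proof.
move=> tP; elim: k => [|k IH]; last by rewrite !exprS mulnS; exact: top_coefM.
by rewrite !expr0 muln0; split; rewrite ?size_poly1 // coefC eqxx.
Qed.
End TopCoef.

Lemma top_line (K : fieldType) (S : comNzRingType) (iota : {rmorphism K -> S})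
    N (p v : 'I_N -> S) d (f : {mpoly K[N]}) :
  f \is d.-homog -> top_coef d (line iota p v f) (mmap iota p f).
Proof.
move=> /dhomogP hf; rewrite /line /mmap big_seq [X in top_coef _ _ X]big_seq.
elim/big_rec2: _ => [|m a P /hf mE [sP Pd]].
  by split; rewrite ?size_poly0 // coef0.
have <- : mdeg m = d by []; rewrite -mE in sP Pd.
have [sT Td] : top_coef (mdeg m) ((polyC \o iota) f@_m *
    mmap1 (fun i => (p i)%:P * 'X + (v i)%:P) m) (iota f@_m * mmap1 p m).
  rewrite -[mdeg m]add0n; apply: top_coefM.
    by split; rewrite /= ?coefC ?eqxx // size_polyC; case: eqP.
  rewrite mdegE /mmap1; elim/big_rec3: _ => [|i d' b Q _ IH].
    by split; rewrite ?size_poly1 // coefC eqxx.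
  apply: top_coefM => //; rewrite -[X in top_coef X]mul1n; apply: top_coefX.
  split; last by rewrite coefD coefMX !coefC /= addr0.
  rewrite (leq_trans (size_polyD _ _)) // geq_max.
  rewrite (leq_trans (size_polyC_leq1 _)) // andbT.
  by have [->|nz] := eqVneq ((p i)%:P : {poly S}) 0;
    rewrite ?mul0r ?size_poly0 // size_mulX // ltnS size_polyC_leq1.
split; last by rewrite coefD Td Pd.
by rewrite (leq_trans (size_polyD _ _)) // geq_max sT.
Qed.

Section RLine.
Variables (K : fieldType) (N : nat).
Implicit Types (f F : {mpoly K[N]}) (p v u : 'rV[K]_N).

Definition rline p v : {mpoly K[N]} -> {poly K} :=
  line idfun (fun i => p 0 i) (fun i => v 0 i).
HB.instance Definition _ p v := GRing.RMorphism.on (rline p v).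

Lemma rlineC p v c : rline p v c%:MP = c%:P. Proof. exact: lineC. Qed.
Lemma rlineX p v i : rline p v 'X_i = (p 0 i)%:P * 'X + (v 0 i)%:P.
Proof. exact: lineX. Qed.

Lemma horner_rline p v f y : (rline p v f).[y] = ev f (y *: p + v).
Proof.
elim/mpoly_ring_ind: f => [c|i|f g IHf IHg|f g IHf IHg].
- by rewrite rlineC hornerC evC.
- by rewrite rlineX evX !mxE !hornerE mulrC.
- by rewrite rmorphD hornerD IHf IHg evD.
- by rewrite rmorphM hornerM IHf IHg evM.
Qed.

Lemma top_rline d f p v : f \is d.-homog -> top_coef d (rline p v f) (ev f p).
Proof. by move=> /(@top_line _ _ idfun _ (fun i => p 0 i) (fun i => v 0 i)). Qed.

Definition dline f p v u : {poly K} := \sum_i u 0 i *: rline p v f^`M(i).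

Lemma horner_dline f p v u y : (dline f p v u).[y] = dev f (y *: p + v) u.
Proof.
rewrite /dline /dev horner_sum; apply: eq_bigr => i _.
by rewrite hornerZ horner_rline mulrC.
Qed.

Lemma dlineD f p v u u' : dline f p v (u + u') = dline f p v u + dline f p v u'.
Proof.
by rewrite -big_split; apply: eq_bigr => i _; rewrite mxE scalerDl.
Qed.

Lemma dlineZ f p v c u : dline f p v (c *: u) = c *: dline f p v u.
Proof.
by rewrite scaler_sumr; apply: eq_bigr => i _; rewrite mxE scalerA.
Qed.

Lemma deriv_rline f p v : (rline p v f)^`() = dline f p v p.
Proof.
rewrite -[LHS]/((deriv \o rline p v) f) (derivation_chain (phi := rline p v)).
- apply: eq_bigr => i _; rewrite /= rlineX derivD derivC addr0 derivM derivC.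
  by rewrite mul0r add0r derivX mulr1 mulrC mul_polyC.
- by move=> c /=; rewrite rlineC derivC.
split=> g h /=; first by rewrite rmorphD derivD.
by rewrite rmorphM derivM addrC [X in _ + X]mulrC.
Qed.
End RLine.

Section MapDev.
Variables (K : fieldType) (k : nat) (x u : 'rV[K]_k).

Lemma dev_derivation :
  derivation_along (meval (fun i => x 0 i)) (fun c : {mpoly K[k]} => dev c x u).
Proof. by split=> a b; rewrite ?devD ?devM. Qed.

(** Chain rule: when [p] and [v] depend on parameters, a first-order variation of the
    parameters moves the point [y p + v] by [y dp + dv]. *)
Lemma map_dev_line N (p v : 'I_N -> {mpoly K[k]}) (F : {mpoly K[N]}) :
  let at_x (c : 'I_N -> {mpoly K[k]}) : 'rV[K]_N := \row_i ev (c i) x in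
  let d_x (c : 'I_N -> {mpoly K[k]}) : 'rV[K]_N := \row_i dev (c i) x u in
  map_poly (fun c => dev c x u) (line (@mpolyC k K) p v F) =
  'X * dline F (at_x p) (at_x v) (d_x p) + dline F (at_x p) (at_x v) (d_x v).
Proof.
move=> at_x d_x; have der := dev_derivation.
set D := map_poly _; set phi := map_poly (meval (fun i => x 0 i)).
rewrite -[LHS]/((D \o line _ p v) F).
rewrite (derivation_chain (phi := phi \o line (@mpolyC k K) p v)).
- rewrite /dline mulr_sumr -big_split; apply: eq_bigr => i _ /=.
  rewrite (map_line (iota' := idfun)) => [|c]; last exact: mevalC.
  set l := line _ _ _ _; have -> : l = rline (at_x p) (at_x v) F^`M(i).
    by congr (line _ _ _ _); apply: funext => j; rewrite mxE.
  rewrite lineX /D (map_derD der) (map_derM der) !(map_derC der) map_polyX.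
  have -> : map_poly (fun c : {mpoly K[k]} => dev c x u) 'X = 0.
    apply/polyP => j; rewrite (coef_map_id0 _ _ (der0 der)) coefX coef0.
    by case: eqP => _; rewrite -?mpolyC0 -?mpolyC1 devC.
  rewrite mulr0 add0r mulrDr !mxE -!mul_polyC; ring.
- by move=> c; rewrite /D /= lineC (map_derC der) devC.
split=> f g; first by rewrite /D /= rmorphD (map_derD der).
by rewrite /D /= rmorphM (map_derM der).
Qed.

Lemma map_dev_sqr (B : {poly {mpoly K[k]}}) :
  map_poly (fun c => dev c x u) (B ^+ 2) =
  map_poly (meval (fun i => x 0 i)) B * (2%:R * map_poly (fun c => dev c x u) B).
Proof. by rewrite expr2 (map_derM dev_derivation); ring. Qed.
End MapDev.

(** * Free lines *)

(** A square root [B] of [F] on the line [y p + v] gives a lift of the line to the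
    double cover.  When [p] and [v] move with velocities [e] and [w], the first-order
    variation of [F (y p + v)] must be [2 B dB] for the lift to follow: so this says
    that every lift deforms with [p] moving in the direction [e]. *)
Definition free_at (K : fieldType) (N m : nat) (F : {mpoly K[N]})
    (p e : 'rV[K]_N) :=
  forall v (B : {poly K}), (size B <= m.+1)%N -> rline p v F = B ^+ 2 ->
  exists w g, 'X * dline F p v e + dline F p v w = B * g.

(** [generic_tangent] applied to the variety of triples [(p, v, B)] with
    [F (y p + v) = B^2], whose equations are the coefficients in [y] of the
    polynomial [Q] below.  The tangent vectors of this variety are the first-order
    deformations of the lifted lines. *)
Lemma generic_free_at (K : fieldType) (N m : nat) (F : {mpoly K[N]})
    (e : 'rV[K]_N) :
  (forall n, n.+1%:R != 0 :> K) ->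
  exists2 D : {mpoly K[N]}, D != 0 & forall p, ~ free_at m F p e -> ev D p = 0.
Proof.
move=> char0; apply: contrapT => noD.
pose nonfree p (vB : 'rV[K]_N * {poly K}) := [/\ (size vB.2 <= m.+1)%N,
  rline p vB.1 F = vB.2 ^+ 2 & ~ exists w g,
  'X * dline F p vB.1 e + dline F p vB.1 w = vB.2 * g].
have /choice[vB vBP] p : exists x, ~ free_at m F p e -> nonfree p x.
  have [fp|] := pselect (free_at m F p e); first by exists (0, 0).
  by move=> /existsNP[v /existsNP[B /not_implyP[sB /not_implyP[FB nf]]]];
    exists (v, B) => _; split.
pose Y p : 'rV[K]_(N + m.+1) := row_mx (vB p).1 (poly_rV (vB p).2).
pose xp i : {mpoly K[N + (N + m.+1)]} := 'X_(lshift _ i).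
pose xv i : {mpoly K[N + (N + m.+1)]} := 'X_(rshift _ (lshift _ i)).
pose xB : {poly {mpoly K[N + (N + m.+1)]}} :=
  rVpoly (\row_k 'X_(rshift _ (rshift _ k))).
pose Q := line (@mpolyC _ K) xp xv F - xB ^+ 2.
have atp p y : \row_i ev (xp i) (row_mx p y) = p.
  by apply/rowP => i; rewrite mxE evX row_mxEl.
have atv p v b : \row_i ev (xv i) (row_mx p (row_mx v b)) = v.
  by apply/rowP => i; rewrite mxE evX row_mxEr row_mxEl.
have atB p v b : map_poly (meval (fun i => row_mx p (row_mx v b) 0 i)) xB = rVpoly b.
  rewrite map_rVpoly; congr rVpoly; apply/rowP => i.
  by rewrite !mxE /= mevalXU row_mxEr row_mxEr.
have [||p nfp [u uP]] := @generic_tangent K N (N + m.+1) Q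
    (fun p => ~ free_at m F p e) Y e char0.
- move=> p /vBP[sB FB _] f; case/(nthP 0) => i iQ <-.
  rewrite -[LHS](coef_map (meval (fun i => row_mx p (Y p) 0 i))).
  rewrite rmorphB rmorphXn /= atB (map_line (iota' := idfun)) => [|c]; last exact: mevalC.
  rewrite poly_rV_K // -FB; apply/eqP; rewrite coefB subr_eq0; apply/eqP.
  congr ((line _ _ _ _)`_ _); apply: funext => j; first by rewrite -[in RHS](atp p (Y p)) mxE.
  by rewrite -[in RHS](atv p (vB p).1 (poly_rV (vB p).2)) mxE.
- move=> D D0; apply: contrapT => nD; apply: noD; exists D => // p nf.
  by apply/eqP/negPn/negP => Dp; apply: nD; exists p.
case: (vBP p nfp) => sB FB; apply.
have DQ : map_poly (fun c => dev c (row_mx p (Y p)) (row_mx e u)) Q = 0.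
  apply/polyP => i; rewrite (coef_map_id0 _ _ (der0 (dev_derivation _ _))) coef0.
  have [iQ|iQ] := ltnP i (size Q); first by apply: uP; rewrite mem_nth.
  by rewrite nth_default // -mpolyC0 devC.
exists (lsubmx u), (2%:R * map_poly (fun c => dev c (row_mx p (Y p)) (row_mx e u)) xB).
have := map_dev_sqr (row_mx p (Y p)) (row_mx e u) xB.
rewrite atB poly_rV_K // => <-.
have /= := map_dev_line (row_mx p (Y p)) (row_mx e u) xp xv F.
rewrite atp atv => /esym; set w1 := \row_i _; set w2 := \row_i _.
have -> : w1 = e by apply/rowP => i; rewrite mxE devX row_mxEl.
have -> : w2 = lsubmx u by apply/rowP => i; rewrite mxE devX row_mxEr mxE.
move=> ->; rewrite -[line _ _ _ _](subrK (xB ^+ 2)) -/Q.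
by rewrite (map_derD (dev_derivation _ _)) DQ add0r.
Qed.

Lemma ev_homog (K : fieldType) (N d : nat) (f : {mpoly K[N]}) c (p : 'rV[K]_N) :
  f \is d.-homog -> ev f (c *: p) = c ^+ d * ev f p.
Proof.
move=> /dhomogP hf; rewrite /ev !mevalE mulr_sumr !big_seq.
apply: eq_bigr => m /hf mE; have <- : mdeg m = d by [].
rewrite mulrCA mdegE -prodrXr -big_split; congr (_ * _).
by apply: eq_bigr => i _; rewrite /= mxE exprMn.
Qed.

(** In characteristic zero the positive integers are pairwise distinct. *)
Lemma infinite_roots (K : fieldType) (q : {poly K}) :
  (forall n, n.+1%:R != 0 :> K) -> (forall k, q.[k.+1%:R] = 0) -> q = 0.
Proof.
move=> char0 q0; apply/eqP/negPn/negP => nz.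
have H k l : (k < l)%N -> k.+1%:R != l.+1%:R :> K.
  move=> kl; rewrite eq_sym -subr_eq0 -natrB ?ltnS ?(ltnW kl) // subSS.
  by move: kl; rewrite -subn_gt0; case: (l - k)%N.
have inj : injective (fun k => k.+1%:R : K).
  by move=> k l /eqP kl; case: (ltngtP k l) => // /H;
    rewrite ?(eqP kl) ?eqxx // eq_sym (eqP kl) eqxx.
have := @max_poly_roots _ q [seq k.+1%:R | k <- iota 0 (size q)] nz.
rewrite map_inj_uniq // iota_uniq size_map size_iota ltnn => /(_ _ isT).
suff /[swap]/[apply] : all (root q) [seq k.+1%:R | k <- iota 0 (size q)] by [].
by apply/allP => _ /mapP[k _ ->]; rewrite rootE q0.
Qed.

(** Evaluating at the multiples [c *: p] of a point of the cone, for infinitely many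
    [c], separates the components of different degrees. *)
Lemma homogeneous_vanishing (K : fieldType) (N : nat) (D : {mpoly K[N]})
    (C : 'rV[K]_N -> Prop) :
  (forall n, n.+1%:R != 0 :> K) -> D != 0 ->
  (forall c p, c != 0 -> C p -> C (c *: p)) -> (forall p, C p -> ev D p = 0) ->
  exists E d, [/\ E != 0, E \is d.-homog & forall p, C p -> ev E p = 0].
Proof.
move=> char0 D0 coneC DC.
have DE := pihomog_partitionE (mf := mdeg) (leqnn (msize D)).
have [d Dd] : exists d : 'I_(msize D), pihomog mdeg d D != 0.
  apply/existsP; apply: contraNT D0; rewrite negb_exists => /forallP D0.
  by rewrite DE big1 // => i _; apply/eqP/negPn.
exists (pihomog mdeg d D), d; split=> //; first exact: pihomogP.
move=> p Cp; pose q := \poly_(e < msize D) ev (pihomog mdeg e D) p.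
suff : q = 0 by move/(congr1 (fun r : {poly K} => r`_d)); rewrite coef_poly coef0 ltn_ord.
apply: infinite_roots => // k.
rewrite horner_poly; transitivity (ev D (k.+1%:R *: p)); last exact/DC/coneC.
rewrite [in RHS]DE /ev rmorph_sum; apply: eq_bigr => e _.
by rewrite mulrC; exact/esym/ev_homog/pihomogP.
Qed.

Section Free.
Variables (K : fieldType) (N m : nat) (F : {mpoly K[N]}).
Implicit Types (p v e u : 'rV[K]_N).

Lemma rline_scale c p v f : rline (c *: p) v f = rline p v f \Po (c *: 'X).
Proof.
elim/mpoly_ring_ind: f => [a|i|f g IHf IHg|f g IHf IHg].
- by rewrite !rlineC comp_polyC.
- rewrite !rlineX comp_polyD comp_polyM !comp_polyC comp_polyX mxE.
  by rewrite polyCM -mulrA mulrCA -!mul_polyC.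
- by rewrite !rmorphD /= IHf IHg.
- by rewrite !rmorphM /= IHf IHg.
Qed.

Lemma dline_scale c p v u : dline F (c *: p) v u = dline F p v u \Po (c *: 'X).
Proof.
rewrite /dline [RHS]rmorph_sum; apply: eq_bigr => i _ /=.
by rewrite rline_scale comp_polyZ.
Qed.

Lemma free_at_scale c p e : c != 0 -> free_at m F (c *: p) e -> free_at m F p e.
Proof.
move=> c0 fr v B sB FB.
have sB' : (size (B \Po (c *: 'X)) <= m.+1)%N.
  apply: leq_trans (size_comp_poly_leq _ _) _.
  by rewrite size_scale // size_polyX muln1; case: (size B) sB.
have [|w [g wg]] := fr v _ sB'; first by rewrite rline_scale FB rmorphXn.
exists (c *: w), (c *: (g \Po (c^-1 *: 'X))).
have XX : (c *: 'X) \Po (c^-1 *: 'X) = 'X :> {poly K}.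
  by rewrite comp_polyZ comp_polyX scalerA divff // scale1r.
move/(congr1 (fun q => c *: (q \Po (c^-1 *: 'X)))): wg.
rewrite !dline_scale comp_polyD !comp_polyM -!comp_polyA XX !comp_polyXr comp_polyX.
rewrite dlineZ scalerDr -scalerAl scalerA divff // scale1r => ->.
by rewrite -scalerAr.
Qed.

Lemma free_at_delta p :
  (forall j, free_at m F p (delta_mx 0 j)) -> forall e, free_at m F p e.
Proof.
move=> fr e v B sB FB.
have /choice[w /choice[g wg]] j := fr j v B sB FB.
exists (\sum_j e 0 j *: w j), (\sum_j e 0 j *: g j).
have lin (a : 'I_N -> 'rV[K]_N) :
    dline F p v (\sum_j e 0 j *: a j) = \sum_j e 0 j *: dline F p v (a j).
  rewrite (big_morph _ (dlineD F p v) (_ : dline F p v 0 = 0)).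
    by apply: eq_bigr => j _; rewrite dlineZ.
  by rewrite -(scale0r 0) dlineZ scale0r.
rewrite {1}[e]row_sum_delta !lin !mulr_sumr -big_split; apply: eq_bigr => j _ /=.
by rewrite -!scalerAr -scalerDr wg.
Qed.

Lemma generic_free d : (forall n, n.+1%:R != 0 :> K) ->
  F != 0 -> F \is d.-homog ->
  exists D k, [/\ D != 0, D \is k.-homog & forall p, ev D p != 0 ->
    ev F p != 0 /\ forall e, free_at m F p e].
Proof.
move=> char0 F0 hF.
have /choice[D DP] (j : 'I_N) : exists E, [/\ E != 0, exists k, E \is k.-homog
    & forall p, ~ free_at m F p (delta_mx 0 j) -> ev E p = 0].
  have [D D0 DP] := @generic_free_at K N m F (delta_mx 0 j) char0.
  have [|E [k [E0 hE EP]]] := homogeneous_vanishing char0 D0 _ DP.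
    by move=> c p c0 nf /(free_at_scale c0).
  by exists E; split=> //; exists k.
have [k hD] : exists k, \prod_j D j \is k.-homog.
  elim/big_ind: _ => [|f g [a hf] [b hg]|j _]; last by have [] := DP j.
    by exists 0%N; rewrite dhomog1.
  by exists (a + b)%N; exact: dhomogM.
exists (F * \prod_j D j), (d + k)%N; split; last 1 first.
- move=> p; rewrite evM mulf_eq0 negb_or => /andP[Fp Dp]; split=> //.
  apply: free_at_delta => j; apply: contrapT => nf.
  by case/negP: Dp; rewrite (bigD1 j) //= evM; have [_ _ ->//] := DP j; rewrite mul0r.
- by rewrite mulf_neq0 // prodf_seq_neq0; apply/allP => j _ /=; have [] := DP j.
- exact: dhomogM.
Qed.

End Free.

(** The residues modulo [B] of the derivatives of [F] form a linear space, which
    freeness makes stable under multiplication by [y].  So it is an ideal of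
    [K[y]/(B)], and a proper ideal would produce a singular point of [F = 0] on
    the line. *)
Lemma dline_generate (K : closedFieldType) (N m : nat) (F : {mpoly K[N]})
    (p v : 'rV[K]_N) (B : {poly K}) :
  B != 0 -> (size B <= m.+1)%N ->
  rline p v F = B ^+ 2 -> (forall e, free_at m F p e) ->
  (forall y, y *: p + v != 0) ->
  (forall x, x != 0 -> ev F x = 0 -> exists i, ev F^`M(i) x != 0) ->
  forall r, exists u g, r = dline F p v u + B * g.
Proof.
move=> B0 sB FB fr pv smooth.
(* The inverse image in [K[y]] of the space of residues. *)
pose I (r : {poly K}) := exists u g, r = dline F p v u + B * g.
have ID r r' : I r -> I r' -> I (r + r').
  move=> [u [g ->]] [u' [g' ->]]; exists (u + u'), (g + g').
  by rewrite dlineD; ring.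
have IZ c r : I r -> I (c *: r).
  move=> [u [g ->]]; exists (c *: u), (c *: g).
  by rewrite dlineZ scalerDr -scalerAr.
have IB g : I (B * g).
  by exists 0, g; rewrite -(scale0r 0) dlineZ scale0r add0r.
have IX r : I r -> I ('X * r).
  move=> [u [g ->]]; have [w [h E]] := fr u v B sB FB.
  exists ((-1) *: w), (h + 'X * g); rewrite dlineZ scaleN1r.
  have -> : 'X * (dline F p v u + B * g) =
    ('X * dline F p v u + dline F p v w) - dline F p v w + B * ('X * g) by ring.
  by rewrite E; ring.
have IM q r : I r -> I (q * r).
  move=> Ir; elim/poly_ind: q => [|q c IH]; first by rewrite mul0r -(mulr0 B).
  rewrite mulrDl -mulrA mulrCA mul_polyC; apply: ID; last exact: IZ.
  exact: IX.
suff I1 : I 1 by move=> r; rewrite -[r]mulr1; exact: IM.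
(* If [1] is not in the ideal, its generator [a] has a root [y]. *)
have exd : exists d, `[< exists2 r, I r & r != 0 /\ size r = d >].
  by exists (size B); apply/asboolP; exists B => //; rewrite -[B]mulr1.
case: (ex_minnP exd) => d /asboolP[a Ia [a0 sa]] mind.
have dvd r : I r -> r %% a = 0.
  move=> Ir; apply/eqP/negPn/negP => r0.
  have /mind : `[< exists2 s, I s & s != 0 /\ size s = size (r %% a) >].
    apply/asboolP; exists (r %% a) => //.
    have -> : r %% a = r + (-1) *: (r %/ a * a).
      by rewrite {2}(divp_eq r a) scaleN1r addrAC subrr add0r.
    by apply: ID => //; apply/IZ/IM.
  by rewrite leqNgt -sa ltn_modp a0.
have [/eqP/size_poly1P[c c0 ac]|a1] := eqVneq (size a) 1%N.
  by have := IZ c^-1 _ Ia; rewrite ac -mul_polyC -polyCM mulVf.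
have [y ay] : exists y, root a y by apply/closed_rootP.
have rooty r : I r -> r.[y] = 0.
  move=> /dvd ra; rewrite (divp_eq r a) ra addr0 hornerM.
  by move/rootP: ay => ->; rewrite mulr0.
have By : B.[y] = 0 by apply: rooty; rewrite -[B]mulr1.
have [] := smooth (y *: p + v) (pv y).
  by rewrite -horner_rline FB horner_exp By expr0n.
move=> i; rewrite -horner_rline => /eqP[]; apply: rooty.
exists (delta_mx 0 i), 0; rewrite mulr0 addr0 /dline (bigD1 i) //= mxE !eqxx.
rewrite scale1r big1 ?addr0 // => j ji.
by rewrite mxE eqxx (negPf ji) scale0r.
Qed.

(** * Linear forms and the hyperplane of directions *)

(** The partial derivatives of a polynomial that vanishes everywhere vanish
    everywhere, and each coefficient is, up to a nonzero integer, the value at the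
    origin of an iterated derivative. *)
Lemma mpoly_eq0_ev (K : fieldType) (N : nat) (f : {mpoly K[N]}) :
  (forall n, n.+1%:R != 0 :> K) -> (forall v, ev f v = 0) -> f = 0.
Proof.
move=> char0 f0; apply/mpolyP => mu; rewrite mcoeff0.
elim: {mu}(mdeg mu) {-2}mu (erefl (mdeg mu)) f f0 => [|d IH] mu mud f f0.
  have -> : mu = 0%MM by apply/eqP; rewrite -mdeg_eq0 mud.
  suff <- : ev f 0 = f@_0 by [].
  elim/mpoly_ring_ind: {f0} f => [c|i|f g IHf IHg|f g IHf IHg].
  - by rewrite evC mcoeffC eqxx mulr1.
  - by rewrite evX mxE mcoeffX -mdeg_eq0 mdeg1.
  - by rewrite evD mcoeffD IHf IHg.
  - by rewrite evM IHf IHg rmorphM.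
have [i mui] : exists i, mu i != 0%N.
  apply/existsP; apply: contra_eqT mud; rewrite negb_exists => /forallP mu0.
  by rewrite mdegE big1 // => i _; apply/eqP/negPn.
pose mu' := (mu - U_(i))%MM.
have muE : mu = (mu' + U_(i))%MM by rewrite submK // lep1mP.
have : (f^`M(i))@_mu' = 0.
  apply: IH => [|v].
    by apply: succn_inj; rewrite -mud muE mdegD mdeg1 addn1.
  have : rline (delta_mx 0 i) v f = 0.
    by apply: infinite_roots => // k; rewrite horner_rline.
  move/(congr1 (fun q => q^`().[0])); rewrite deriv_rline deriv0 horner0.
  rewrite horner_dline scale0r add0r /dev (bigD1 i) //= mxE !eqxx mulr1.
  rewrite big1 ?addr0 // => j ji; by rewrite mxE (negPf ji) andbF mulr0.
rewrite mcoeff_deriv -muE -mulr_natr => /eqP.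
by rewrite mulf_eq0 (negPf (char0 _)) orbF => /eqP.
Qed.

Lemma euler_identity (K : fieldType) (N d : nat) (f : {mpoly K[N]}) (p : 'rV[K]_N) :
  (forall n, n.+1%:R != 0 :> K) -> f \is d.-homog -> dev f p p = d%:R * ev f p.
Proof.
move=> char0 hf.
have E : rline p 0 f = ev f p *: 'X^d.
  apply/eqP; rewrite -subr_eq0; apply/eqP; apply: infinite_roots => // k.
  by rewrite !hornerE horner_rline addr0 (ev_homog _ _ hf) mulrC subrr.
have := deriv_rline f p 0 => /(congr1 (fun q => q.[1])).
rewrite horner_dline scale1r addr0 E => <-.
by rewrite derivZ derivXn !hornerE hornerMn ?hornerXn expr1n mulrC.
Qed.

Lemma dev_scale (K : fieldType) (N : nat) (f : {mpoly K[N]}) c (v w : 'rV[K]_N) :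
  dev f v (c *: w) = c * dev f v w.
Proof.
by rewrite /dev mulr_sumr; apply: eq_bigr => i _; rewrite mxE mulrCA.
Qed.

Section Linear.
Variables (K : fieldType) (N : nat) (f : {mpoly K[N]}).
Hypothesis hf : f \is 1.-homog.

Lemma rline_linear p v : rline p v f = (ev f p)%:P * 'X + (ev f v)%:P.
Proof.
have [sf f1] := top_rline p v hf.
have f0 : (rline p v f)`_0 = ev f v.
  by rewrite -horner_coef0 horner_rline scale0r add0r.
apply/polyP => i; rewrite coefD coefCM coefX coefC.
case: i => [|[|i]] /=; rewrite ?mulr0 ?mulr1 ?add0r ?addr0 //.
by rewrite nth_default // (leq_trans sf).
Qed.

Lemma ev_linear a p v : ev f (a *: p + v) = a * ev f p + ev f v.
Proof. by rewrite -horner_rline rline_linear !hornerE mulrC. Qed.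

Lemma dev_linear v u : dev f v u = ev f u.
Proof.
have := deriv_rline f u v => /(congr1 (fun q => q.[0])).
rewrite horner_dline scale0r add0r => <-; rewrite rline_linear.
by rewrite derivD derivC addr0 mul_polyC derivZ derivX !hornerE.
Qed.
End Linear.

(** A line in the source of linear forms [lq] is mapped to a line in the target. *)
Lemma rline_comp (K : fieldType) (N k : nat) (lq : N.-tuple {mpoly K[k]})
    (t u : 'rV[K]_k) (f : {mpoly K[N]}) :
  (forall i, tnth lq i \is 1.-homog) ->
  rline (\row_i ev (tnth lq i) t) (\row_i ev (tnth lq i) u) f =
  rline t u (f \mPo lq).
Proof.
move=> hlq; elim/mpoly_ring_ind: f => [c|i|f g IHf IHg|f g IHf IHg].
- by rewrite comp_mpolyC !rlineC.
- rewrite rlineX !mxE /comp_mpoly mmapX mmap1U.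
  by rewrite (rline_linear (hlq i)).
- by rewrite !rmorphD /= IHf IHg.
- by rewrite !rmorphM /= IHf IHg.
Qed.

Section Hyperplane.
Variables (K : fieldType) (n : nat) (i0 : 'I_n.+1).
Implicit Types (p t : 'rV[K]_n.+1) (w : 'rV[K]_n) (c y : K).

(** The hyperplane of vectors with zero coordinate at [i0], which is a complement of
    the line spanned by [p] when [p 0 i0 != 0]; [proj_along] is the projection onto
    it with kernel this line. *)
Definition ins (w : 'rV[K]_n) : 'rV[K]_n.+1 :=
  \row_i oapp (fun j => w 0 j) 0 (unlift i0 i).

Definition proj_along (p t : 'rV[K]_n.+1) : 'rV[K]_n :=
  \row_j (t 0 (lift i0 j) - t 0 i0 / p 0 i0 * p 0 (lift i0 j)).

Lemma ins_i0 w : ins w 0 i0 = 0. Proof. by rewrite mxE unlift_none. Qed.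

Lemma ins_inj : injective ins.
Proof.
move=> w w' /rowP E; apply/rowP => j.
by have := E (lift i0 j); rewrite !mxE liftK.
Qed.

Lemma proj_alongK p t : p 0 i0 != 0 -> ins (proj_along p t) = t - (t 0 i0 / p 0 i0) *: p.
Proof.
move=> p0; apply/rowP => i; rewrite !mxE.
case: (unliftP i0 i) => [j ->|->] /=; first by rewrite mxE.
by rewrite divfK // subrr.
Qed.

Lemma proj_along_ins p w : p 0 i0 != 0 -> proj_along p (ins w) = w.
Proof.
move=> p0; apply: ins_inj; rewrite proj_alongK // ins_i0 mul0r scale0r subr0 //.
Qed.

Lemma proj_alongZ p c : p 0 i0 != 0 -> proj_along p (c *: p) = 0.
Proof.
move=> p0; apply/rowP => j; rewrite !mxE mulfK ?subrr //.
Qed.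

Lemma ins_indep p w y : p 0 i0 != 0 -> w != 0 -> y *: p + ins w != 0.
Proof.
move=> p0 w0; apply: contra w0 => /eqP E.
have := congr1 (fun t : 'rV_n.+1 => t 0 i0) E.
rewrite !mxE unlift_none addr0 => /eqP; rewrite mulf_eq0 (negPf p0) orbF => /eqP y0.
move: E; rewrite y0 scale0r add0r => E; apply/eqP/ins_inj; rewrite E.
by apply/rowP => i; rewrite !mxE; case: unlift => //= j; rewrite mxE.
Qed.

Definition tangent_proj p (tau : 'rV[K]_n.+1 * K^o) : 'rV[K]_n := proj_along p tau.1.
Lemma tangent_proj_linear p : linear (tangent_proj p).
Proof.
by move=> c t t'; apply/rowP => j; rewrite /tangent_proj !mxE; ring.
Qed.
HB.instance Definition _ p := GRing.isLinear.Build K ('rV[K]_n.+1 * K^o)%type 'rV[K]_n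
  _ (tangent_proj p) (tangent_proj_linear p).
End Hyperplane.

(** * The equations of the variety of tangents *)

Section Forms.
Variables (K : closedFieldType) (n m : nat) (F : {mpoly K[n.+1]}).
Variables (p : 'rV[K]_n.+1) (s : K) (i0 : 'I_n.+1).
Hypotheses (char0 : forall k, k.+1%:R != 0 :> K) (hF : F \is (2 * m).-homog).
Hypotheses (pi0 : p 0 i0 != 0) (s0 : s != 0) (sF : s ^+ 2 = ev F p).
Implicit Types (w u : 'rV[K]_n).
Local Notation ins := (@ins K n i0).
Local Notation at_ w := (map_poly (meval (fun i => w 0 i))).

(** The restrictions of [F] to all the lines [y p + w] at once: the coordinates of
    [w] are the variables of the coefficients. *)
Definition hyper_line : {poly {mpoly K[n]}} :=
  line (@mpolyC n K) (fun i => (p 0 i)%:MP)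
    (fun i => oapp (fun j => 'X_j) 0 (unlift i0 i)) F.

Lemma at_hyper_line w : at_ w hyper_line = rline p (ins w) F.
Proof.
rewrite /hyper_line (map_line (iota' := idfun)) => [|c]; last exact: mevalC.
congr (line _ _ _ _); apply: funext => i /=; first exact: mevalC.
by rewrite mxE; case: unlift => [j|] /=; rewrite ?mevalXU ?meval0.
Qed.

Lemma dev_hyper_line w u :
  map_poly (fun c => dev c w u) hyper_line = dline F p (ins w) (ins u).
Proof.
have := map_dev_line w u (fun i => (p 0 i)%:MP)
    (fun i => oapp (fun j => 'X_j) 0 (unlift i0 i)) F.
cbv zeta; rewrite -/hyper_line => ->.
set a := \row_i _; set b := \row_i _; set c := \row_i _; set d := \row_i _.
have -> : a = p by apply/rowP => i; rewrite mxE evC.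
have -> : b = ins w.
  by apply/rowP => i; rewrite !mxE; case: unlift => [j|] /=; rewrite ?evX -?mpolyC0 ?evC.
have -> : c = 0 by apply/rowP => i; rewrite !mxE devC.
have -> : d = ins u.
  by apply/rowP => i; rewrite !mxE; case: unlift => [j|] /=; rewrite ?devX -?mpolyC0 ?devC.
by rewrite -(scale0r (0 : 'rV_n.+1)) dlineZ scale0r mulr0 add0r.
Qed.

(** [B] is the only candidate for the lift of a line through [(p, s)], and the
    coefficients of [R] are the obstructions to lifting. *)
Lemma hyper_line_sqrt : exists B R : {poly {mpoly K[n]}},
  [/\ hyper_line = B ^+ 2 + R, bihomog (2 * m) R, (size R <= m)%N &
   (size B <= m.+1)%N /\ B`_m = s%:MP].
Proof.
have hP : bihomog (2 * m) hyper_line.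
  apply: bihomog_line => // i.
    by rewrite dhomogE msuppC; case: ifP => //= _; rewrite mdeg0.
  by case: unlift => [j|] /=; rewrite ?dhomog0 // dhomogX; apply/eqP/mdeg1.
have Ptop : hyper_line`_(2 * m) = (s ^+ 2)%:MP.
  rewrite (top_line _ _ _ hF).2 sF.
  elim/mpoly_ring_ind: (F) => [c|i|f g IHf IHg|f g IHf IHg].
  - by rewrite mmapC evC.
  - by rewrite mmapX mmap1U evX.
  - by rewrite !rmorphD /= IHf IHg evD rmorphD.
  - by rewrite !rmorphM /= IHf IHg evM rmorphM.
have [B [hB Bm sR]] := truncated_sqrt (char0 1) s0 hP Ptop.
exists B, (hyper_line - B ^+ 2); split=> //; first by rewrite addrC subrK.
  by apply: bihomogD => //; apply: bihomogN; rewrite mulnC; exact: bihomogXn.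
split=> //; apply/leq_sizeP => k mk; have := (bihomogP _ _).1 hB k.
by rewrite leqNgt mk => /eqP.
Qed.

Variables (B R : {poly {mpoly K[n]}}).
Hypotheses (PBR : hyper_line = B ^+ 2 + R) (sR : (size R <= m)%N).
Hypotheses (sB : (size B <= m.+1)%N) (Bm : B`_m = s%:MP).

Lemma rline_ins w : rline p (ins w) F = (at_ w B) ^+ 2 + at_ w R.
Proof. by rewrite -at_hyper_line PBR rmorphD rmorphXn. Qed.

Lemma top_at_B w : top_coef m (at_ w B) s.
Proof.
split; first exact: leq_trans (size_poly _ _) sB.
by rewrite coef_map Bm /= mevalC.
Qed.

Lemma size_at_R w : (size (at_ w R) <= m)%N.
Proof. exact: leq_trans (size_poly _ _) sR. Qed.

Lemma size_top (P : {poly K}) a : top_coef m P a -> a != 0 -> size P = m.+1.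
Proof.
move=> [sP Pm] a0; apply/eqP; rewrite eqn_leq sP /= ltnNge.
by apply: contra a0 => /leq_sizeP/(_ m (leqnn m)); rewrite Pm => ->.
Qed.

(** [R = (G - B) (G + B)] on the line, and [G + B] has degree [m] with leading
    coefficient [2 s], whereas [R] has degree less than [m]. *)
Lemma sqrt_unique w (G : {poly K}) :
  top_coef m G s -> rline p (ins w) F = G ^+ 2 -> at_ w R = 0.
Proof.
move=> [sG Gm]; rewrite rline_ins => E.
have [sBw Bwm] := top_at_B w.
have {E} E : at_ w R = (G - at_ w B) * (G + at_ w B).
  by rewrite -subr_sqr -E addrAC subrr add0r.
have sD : size (G + at_ w B) = m.+1.
  apply: (@size_top _ (s + s)).
    split; last by rewrite coefD Gm Bwm.
    by rewrite (leq_trans (size_polyD _ _)) // geq_max sG.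
  by rewrite -mulr2n -mulr_natl mulf_neq0 // char0.
apply/eqP/negPn/negP => R0.
have := size_at_R w; rewrite E size_mul.
- rewrite sD addnS /= -{2}[m]add0n leq_add2r leqn0 size_poly_eq0 => /eqP D0.
  by move: R0; rewrite E D0 mul0r eqxx.
- by apply: contra R0 => /eqP D0; rewrite E D0 mul0r.
- by rewrite -size_poly_gt0 sD.
Qed.

(** On a liftable line, the derivative of [R] in the direction [u] is the remainder
    modulo [B] of the derivative of [F], since [B^2] has derivative [2 B dB].  The
    direction [p], which is not in the hyperplane, contributes nothing: there the
    derivative of [F = B^2] is [2 B B'].  So [dline_generate] applies. *)
Lemma jacobian_onto w :
  (forall e, free_at m F p e) ->
  (forall x, x != 0 -> ev F x = 0 -> exists i, ev F^`M(i) x != 0) ->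
  w != 0 -> at_ w R = 0 -> forall k, (k < m)%N ->
  exists u, map_poly (fun c => dev c w u) R = 'X^k.
Proof.
move=> fr smooth w0 Rw k km.
have FB : rline p (ins w) F = (at_ w B) ^+ 2 by rewrite rline_ins Rw addr0.
have tB := top_at_B w; have sBw := size_top tB s0.
have Bw0 : at_ w B != 0 by rewrite -size_poly_gt0 sBw.
have [t [g Xk]] := dline_generate Bw0 tB.1 FB fr
  (fun y => ins_indep y pi0 w0) smooth 'X^k.
exists (proj_along i0 p t); set u := proj_along i0 p t.
set dR := map_poly _ R.
have sdR : (size dR <= m)%N by exact: leq_trans (size_poly _ _) sR.
pose dB := map_poly (fun c => dev c w u) B.
pose a := t 0 i0 / p 0 i0.
have tE : t = ins u + a *: p by rewrite /u proj_alongK // subrK.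
have dp : dline F p (ins w) p = 2%:R * at_ w B * (at_ w B)^`().
  by rewrite -deriv_rline FB expr2 derivM; ring.
have E : 'X^k - dR = at_ w B * (2%:R * dB + a *: (2%:R * (at_ w B)^`()) + g).
  rewrite Xk tE dlineD dlineZ dp -dev_hyper_line PBR.
  rewrite (map_derD (dev_derivation _ _)) map_dev_sqr -/dR -/dB -!mul_polyC.
  ring.
apply/eqP; rewrite eq_sym -subr_eq0; apply/negPn/negP => nz.
have : (size ('X^k - dR)%R <= m)%N.
  by rewrite (leq_trans (size_polyD _ _)) // geq_max size_polyN size_polyXn km.
move: nz; rewrite E mulf_eq0 negb_or Bw0 /= => h0.
rewrite size_mul // sBw addSn /= -{2}[m]addn0 leq_add2l leqn0 size_poly_eq0.
by rewrite (negPf h0).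
Qed.

End Forms.

(** * Lifted lines as rational curves *)

Section Curves.
Variables (K : closedFieldType) (n m : nat) (F : {mpoly K[n.+1]}).
Variables (p : 'rV[K]_n.+1) (s : K) (i0 : 'I_n.+1).
Hypotheses (char0 : forall k, k.+1%:R != 0 :> K) (hF : F \is (2 * m).-homog).
Hypotheses (pi0 : p 0 i0 != 0) (s0 : s != 0) (sF : s ^+ 2 = ev F p).
Implicit Types (w : 'rV[K]_n).
Local Notation ins := (@ins K n i0).

(** The curve is [(t0, t1) |-> (t0 p + t1 w, G)], where [G] is the homogenization of
    [B]; it passes through [(p, s)] at [(1, 0)]. *)
Lemma curve_of_section w (B : {poly K}) :
  w != 0 -> top_coef m B s -> rline p (ins w) F = B ^+ 2 ->
  exists2 tau : tot_rep K n, vmrt m F (p, s) tau & proj_along i0 p tau.1 = w.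
Proof.
move=> w0 [sB Bm] FB; set v := ins w.
have v0 : v != 0 by have := ins_indep 0 pi0 w0; rewrite scale0r add0r.
pose L := [tuple p 0 j *: 'X_ord0 + v 0 j *: 'X_ord_max | j < n.+1]
  : n.+1.-tuple {mpoly K[2]}.
pose G : {mpoly K[2]} :=
  \sum_(k < m.+1) B`_k *: ('X_ord0 ^+ k * 'X_ord_max ^+ (m - k)).
have hX (i : 'I_2) : ('X_i : {mpoly K[2]}) \is 1.-homog.
  by rewrite dhomogX; apply/eqP/mdeg1.
have hL j : tnth L j \is 1.-homog.
  by rewrite tnth_mktuple; apply: dhomogD; apply: dhomogZ.
have hG : G \is (m * 1).-homog.
  apply: rpred_sum => k _; apply: dhomogZ.
  have km : (k <= m)%N by rewrite -ltnS.
  have -> : (m * 1 = 1 * k + 1 * (m - k))%N by rewrite muln1 !mul1n subnKC.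
  by apply: dhomogM; apply: dhomogMn.
have evL (t : 'rV[K]_2) : \row_j ev (tnth L j) t = t 0 ord0 *: p + t 0 ord_max *: v.
  apply/rowP => j; rewrite !mxE tnth_mktuple evD /ev !mevalZ !mevalXU.
  by rewrite [_ * t 0 ord0]mulrC [_ * t 0 ord_max]mulrC mxE.
have evG (t : 'rV[K]_2) :
    ev G t = \sum_(k < m.+1) B`_k * (t 0 ord0 ^+ k * t 0 ord_max ^+ (m - k)).
  rewrite /ev /G rmorph_sum; apply: eq_bigr => k _.
  by rewrite /= mevalZ mevalM !rmorphXn /= !mevalXU.
have indep a b : a *: p + b *: v = 0 -> a = 0 /\ b = 0.
  move=> E; have := congr1 (fun x : 'rV_n.+1 => x 0 i0) E.
  rewrite !mxE unlift_none mulr0 addr0 => /eqP.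
  rewrite mulf_eq0 (negPf pi0) orbF => /eqP a0; split=> //.
  by move: E => /eqP; rewrite a0 scale0r add0r scaler_eq0 (negPf v0) orbF => /eqP.
have row2 (t t' : 'rV[K]_2) : t 0 ord0 = t' 0 ord0 ->
    t 0 ord_max = t' 0 ord_max -> t = t'.
  move=> e0 e1; apply/rowP => i; have [->//|i_neq0] := eqVneq i ord0.
  suff -> : i = ord_max by [].
  by apply/val_inj; case: i i_neq0 => -[|[|i]].
have lift_row t : (Defs.lift L G t).1 = t 0 ord0 *: p + t 0 ord_max *: v by exact: evL.
have nobase (t : 'rV[K]_2) : t != 0 -> exists j, ev (tnth L j) t != 0.
  move=> t0; apply/existsP; apply: contraNT t0; rewrite negb_exists => /forallP E.
  have : t 0 ord0 *: p + t 0 ord_max *: v = 0.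
    by rewrite -evL; apply/rowP => j; rewrite !mxE; apply/eqP/negPn/E.
  by move=> /indep[e0 e1]; apply/eqP/row2; rewrite mxE.
have cover : G ^+ 2 = F \mPo L.
  apply/eqP; rewrite -subr_eq0; apply/eqP/mpoly_eq0_ev => // t.
  rewrite evB; have -> : ev (F \mPo L) t = ev F (t 0 ord0 *: p + t 0 ord_max *: v).
    rewrite -evL /ev comp_mpoly_meval.
    by apply: meval_eq => j; rewrite mxE.
  rewrite expr2 evM -expr2; apply/eqP; rewrite subr_eq0 evG; apply/eqP.
  have [t1|t1] := eqVneq (t 0 ord_max) 0.
    rewrite t1 scale0r addr0 (ev_homog _ _ hF) -sF mulnC exprM -exprMn.
    congr (_ ^+ 2); rewrite big_ord_recr /= subnn expr0 mulr1 Bm big1.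
      by rewrite add0r mulrC.
    by move=> k _; rewrite expr0n subn_eq0 leqNgt ltn_ord /= !mulr0.
  have -> : t 0 ord0 *: p + t 0 ord_max *: v =
      t 0 ord_max *: ((t 0 ord0 / t 0 ord_max) *: p + v).
    by rewrite scalerDr scalerA mulrC divfK.
  rewrite (ev_homog _ _ hF) -horner_rline FB horner_exp mulnC exprM -exprMn.
  congr (_ ^+ 2); rewrite (horner_coef_wide _ sB) mulr_sumr.
  apply: eq_bigr => k _; rewrite [RHS]mulrCA; congr (_ * _).
  have km : (k <= m)%N by rewrite -ltnS.
  have -> : t 0 ord_max ^+ m = t 0 ord_max ^+ (m - k) * t 0 ord_max ^+ k.
    by rewrite -exprD subnK.
  by rewrite expr_div_n -mulrA [_ * (_ / _)]mulrC divfK ?expf_neq0 // mulrC.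
have birat : exists (e : nat) (h : {mpoly K[2]}),
  [/\ h != 0, h \is e.-homog & forall t t' : 'rV[K]_2, ev h t != 0 -> ev h t' != 0 ->
    t != 0 -> t' != 0 -> same_point m (Defs.lift L G t) (Defs.lift L G t') ->
    exists2 a : K, a != 0 & t' = a *: t].
  exists 0%N, 1; split; [exact: oner_neq0 | exact: dhomog1 |].
  move=> t t' _ _ _ _ [a a0 /(congr1 fst) /=]; rewrite !evL => E.
  exists a => //; have [] := indep (t' 0 ord0 - a * t 0 ord0)
      (t' 0 ord_max - a * t 0 ord_max).
    move/eqP: E; rewrite -subr_eq0 => /eqP E; rewrite -[RHS]E.
    by rewrite !scalerBl scalerDr !scalerA opprD addrACA.
  by move=> /eqP e0 /eqP e1; apply: row2; rewrite mxE; apply/eqP; rewrite -subr_eq0.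
pose c := @RationalCurve K n m F 1 L G hL hG nobase cover birat.
pose t : 'rV[K]_2 := delta_mx 0 ord0; pose u : 'rV[K]_2 := delta_mx 0 ord_max.
have Gt : ev G t = s.
  rewrite evG big_ord_recr /= subnn expr0 mulr1 Bm /t mxE !eqxx expr1n mulr1.
  rewrite big1 ?add0r // => k _; rewrite /= mxE /= expr0n subn_eq0.
  by rewrite leqNgt ltn_ord /= !mulr0.
have Lt : \row_j ev (tnth L j) t = p.
  by rewrite evL /t !mxE /= scale1r scale0r addr0.
have dL : \row_j dev (tnth L j) t u = v.
  have <- : \row_j ev (tnth L j) u = v.
    by rewrite evL /u !mxE /= scale1r scale0r add0r.
  by apply/rowP => j; rewrite !mxE (dev_linear (hL j)).
exists (dlift L G t u); last by rewrite /= dL proj_along_ins.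
split.
  move=> [a /(congr1 fst) /=]; rewrite dL => E.
  by case/eqP: w0; rewrite -[w](proj_along_ins w pi0) -/v E proj_alongZ.
exists c; split.
  split=> //=; apply: contraNneq (expf_neq0 2 s0) => F0.
  by rewrite -Gt expr2 -evM -expr2 cover F0 -mpolyC0 evC.
exists t, u; split=> //=.
  apply/negP => /eqP/rowP/(_ ord0); rewrite !mxE /= => /eqP.
  by rewrite oner_eq0.
by rewrite /Defs.lift Lt Gt.
Qed.

(** A curve of degree 1 is a lifted line, parametrized by [y t + u].  Subtracting from
    [u] a multiple of [t] brings its image into the hyperplane. *)
Lemma section_of_curve tau :
  vmrt m F (p, s) tau ->
  exists2 G, top_coef m G s & rline p (ins (proj_along i0 p tau.1)) F = G ^+ 2.
Proof.
move=> [_ [c [[_ deg1] [t [u [t0 liftE ->]]]]]].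
have hL j : tnth (rc_base c) j \is 1.-homog by have := rc_base_homog c j; rewrite deg1.
have hG : rc_fibre c \is m.-homog by have := rc_fibre_homog c; rewrite deg1 muln1.
have Lt : \row_j ev (tnth (rc_base c) j) t = p by have := congr1 fst liftE.
have Gt : ev (rc_fibre c) t = s by have := congr1 snd liftE.
have dL : (dlift (rc_base c) (rc_fibre c) t u).1 = \row_j ev (tnth (rc_base c) j) u.
  by apply/rowP => j; rewrite !mxE (dev_linear (hL j)).
rewrite dL; set q := \row_j ev _ u; pose a := q 0 i0 / p 0 i0.
have -> : ins (proj_along i0 p q) = \row_j ev (tnth (rc_base c) j) ((- a) *: t + u).
  rewrite proj_alongK // -/a -scaleNr -Lt addrC; apply/rowP => j.
  by rewrite !mxE (ev_linear (hL j)).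
exists (rline t ((- a) *: t + u) (rc_fibre c)).
  by rewrite -Gt; exact: top_rline.
by rewrite -{1}Lt (rline_comp _ _ _ hL) -rc_on_cover rmorphXn.
Qed.

End Curves.

(** * Density and the theorem *)

Lemma wev_poly (K : fieldType) (n : nat) (H : {poly {mpoly K[n.+1]}}) (x : tot_rep K n) :
  wev H x = (map_poly (meval (fun i => x.1 0 i)) H).[x.2].
Proof.
rewrite (@horner_coef_wide _ (size H)) ?size_poly //.
by apply: eq_bigr => j _; rewrite coef_map.
Qed.

(** Modulo [s^2 - F] any polynomial is of the form [r1 s + r0].  If it vanishes
    wherever [D] does not, it vanishes at both points over [p] as soon as [D] and [F]
    are nonzero at [p], hence [r0 = r1 = 0] there, and so everywhere. *)
Lemma pullback_dense (K : closedFieldType) (n m d : nat) (F D : {mpoly K[n.+1]}) :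
  (forall k, k.+1%:R != 0 :> K) -> F != 0 -> F \is d.-homog -> (0 < d)%N -> D != 0 ->
  zariski_dense m F (fun x => ev D x.1 != 0).
Proof.
move=> char0 F0 hF d0 D0 V [S [_ VS]] [x Xx Vx].
have [H SH Hx] := (VS x Xx).1 Vx.
apply: contrapT => noy.
pose q : {poly {mpoly K[n.+1]}} := 'X^2 - F%:P.
have mq : q \is monic by rewrite /q monicXnsubC.
pose r := Pdiv.Ring.rmodp H q.
have HE : H = Pdiv.Ring.rdivp H q * q + r by exact: Pdiv.RingMonic.rdivp_eq.
have q0 y : on_cover F y -> (map_poly (meval (fun i => y.1 0 i)) q).[y.2] = 0.
  case=> _ yF; rewrite /q rmorphB rmorphXn /= map_polyX map_polyC /= !hornerE.
  by rewrite [X in X - _]yF subrr.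
have wevE y : on_cover F y -> wev H y = (map_poly (meval (fun i => y.1 0 i)) r).[y.2].
  move=> Xy; rewrite wev_poly HE rmorphD rmorphM hornerD hornerM q0 //.
  by rewrite mulr0 add0r.
have sr : (size r <= 2)%N.
  rewrite -ltnS -(size_XnsubC F (n := 2)) //.
  by rewrite Pdiv.Ring.ltn_rmodpN0 // monic_neq0.
have rE (y : tot_rep K n) : (map_poly (meval (fun i => y.1 0 i)) r).[y.2] =
    ev r`_0 y.1 + ev r`_1 y.1 * y.2.
  rewrite (@horner_coef_wide _ 2) ?(leq_trans (size_poly _ _)) //.
  by rewrite !big_ord_recl big_ord0 /= !coef_map expr0 expr1 mulr1 addr0.
have r0 p : ev D p != 0 -> ev F p != 0 -> ev r`_0 p = 0 /\ ev r`_1 p = 0.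
  move=> Dp Fp.
  have [s sF] : exists s, s ^+ 2 = ev F p.
    have /closed_rootP[s] : size ('X^2 - (ev F p)%:P : {poly K}) != 1%N.
      by rewrite size_XnsubC.
    by rewrite rootE !hornerE subr_eq0 => /eqP; exists s.
  have p0 : p != 0.
    apply: contraNneq Fp => ->; rewrite -(scale0r (0 : 'rV_n.+1)) (ev_homog _ _ hF).
    by rewrite expr0n eqn0Ngt d0 mul0r.
  have s0 : s != 0 by apply: contraNneq Fp => s0; rewrite -sF s0 expr0n.
  have van (z : K) : z ^+ 2 = ev F p -> ev r`_0 p + ev r`_1 p * z = 0.
    move=> zF; have Xz : on_cover F (p, z) by [].
    rewrite -(rE (p, z)) -wevE //; apply/eqP/negPn/negP => Hz; apply: noy.
    by exists (p, z); split=> //; apply/(VS _ Xz); exists H.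
  have e1 := van s sF; have e2 : ev r`_0 p + ev r`_1 p * (- s) = 0.
    by apply: van; rewrite sqrrN.
  have two0 : 2%:R != 0 :> K := char0 1.
  have r00 : ev r`_0 p = 0.
    have : 2%:R * ev r`_0 p = 0.
      by rewrite -[RHS](addr0 0) -{1}e1 -e2; ring.
    by move/eqP; rewrite mulf_eq0 (negPf two0) => /eqP.
  split=> //; move: e1; rewrite r00 add0r => /eqP.
  by rewrite mulf_eq0 (negPf s0) orbF => /eqP.
have rz i : (i < 2)%N -> r`_i = 0.
  move=> i2; suff : r`_i * (F * D) = 0.
    by move/eqP; rewrite !mulf_eq0 (negPf F0) (negPf D0) !orbF => /eqP.
  apply: mpoly_eq0_ev => // p; rewrite !evM.
  have [->|Fp] := eqVneq (ev F p) 0; first by rewrite mul0r mulr0.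
  have [->|Dp] := eqVneq (ev D p) 0; first by rewrite !mulr0.
  by have [e0 e1] := r0 p Dp Fp; case: i i2 => [|[|]] //= _; rewrite ?e0 ?e1 mul0r.
move: Hx; rewrite wevE // rE !rz // -mpolyC0 !evC mul0r addr0 eqxx //.
Qed.

Theorem theorem1p1 (R : realType) (n m : nat) (F : {mpoly R[i][n.+1]}) :
  (3 <= n)%N -> (2 <= m <= n - 1)%N ->
  smooth_hypersurface (2 * m) F ->
  for_general_point m F (fun x =>
    ~ over_branch F x /\
    exists2 chi : {linear tot_rep R[i] n -> 'rV[R[i]]_n},
      tangent_coordinates m F x chi &
      smooth_complete_intersection (iota m.+1 m)
        (fun w => exists2 tau, vmrt m F x tau & chi tau = w)).
Proof.
move=> _ /andP[m2 _] [F0 hF smooth].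
have char0 k : k.+1%:R != 0 :> R[i] by rewrite Num.Theory.pnatr_eq0.
have [D [k [D0 hD good]]] := generic_free m char0 F0 hF.
exists (fun x => ev D x.1 != 0); split.
- (* [D] has degree 0 in the fibre coordinate. *)
  exists (fun H => H = D%:P); split.
    move=> _ ->; exists k => j; rewrite coefC; case: j => [|j] /=.
      by rewrite mul0n subn0.
    by case: ifP; rewrite ?eqxx // dhomog0.
  move=> x _; have wD : wev D%:P x = ev D x.1.
    by rewrite wev_poly map_polyC hornerC.
  by split=> [Dx|[_ -> ]]; [exists D%:P; rewrite ?wD | rewrite wD].
- by apply: pullback_dense char0 F0 hF _ D0; rewrite muln_gt0 (leq_trans _ m2).
case=> p s [/= p0 sF] Dp.
have [Fp fr] := good p Dp.
have s0 : s != 0 by apply: contraNneq Fp => s0; rewrite -sF s0 expr0n.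
split; first exact/eqP.
have [i0 pi0] : exists i0, p 0 i0 != 0.
  apply/existsP; apply: contraNT p0; rewrite negb_exists => /forallP p0.
  by apply/eqP/rowP => i; rewrite mxE; apply/eqP/negPn.
exists (tangent_proj i0 p).
  (* The second coordinate of a tangent vector is determined by the first, as
     [s != 0]. *)
  split=> [[t1 t2] /= tan|w]; last first.
    exists (ins i0 w, dev F p (ins i0 w) / (2%:R * s)).
      by rewrite /cone_tangent /= mulrC divfK // mulf_neq0.
    exact: proj_along_ins.
  split=> [chi0|[a ->]]; last exact: proj_alongZ.
  have t1E : t1 = (t1 0 i0 / p 0 i0) *: p.
    apply/eqP; rewrite -subr_eq0 -(proj_alongK t1 pi0) -/(tangent_proj i0 p (t1, t2)) chi0.
    by apply/eqP/rowP => i; rewrite !mxE; case: unlift => //= j; rewrite mxE.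
  set a := t1 0 i0 / p 0 i0 in t1E; exists a.
  rewrite /euler /= [LHS]surjective_pairing /=.
  congr pair; first exact: t1E.
  move: tan; rewrite /cone_tangent /= t1E dev_scale (euler_identity _ char0 hF) -sF.
  have -> : a * ((2 * m)%:R * s ^+ 2) = (2%:R * s) * (a * (m%:R * s)).
    by rewrite natrM; ring.
  by move/mulfI => ->//; rewrite mulf_neq0.
have [B [Rm [PBR hR sR [sB Bm]]]] := hyper_line_sqrt i0 char0 hF s0 sF.
have szi (i : 'I_(size (iota m.+1 m))) : (i < m)%N.
  by have := ltn_ord i; rewrite [X in (_ < X)%N]size_iota.
have Zw (w : 'rV[R[i]]_n) : w != 0 ->
    (exists2 tau, vmrt m F (p, s) tau & tangent_proj i0 p tau = w) <->
    map_poly (meval (fun i => w 0 i)) Rm = 0.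
  move=> w0; split=> [[tau /(section_of_curve pi0)[G tG FG] <-]|Rw].
    exact: (sqrt_unique char0 s0 PBR sR sB Bm tG FG).
  apply: (curve_of_section char0 hF pi0 s0 sF w0 (top_at_B sB Bm w)).
  by rewrite (rline_ins PBR) Rw addr0.
have Zc (w : 'rV[R[i]]_n) : map_poly (meval (fun i => w 0 i)) Rm = 0 <->
    forall i : 'I_(size (iota m.+1 m)), ev Rm`_(m.-1 - i) w = 0.
  split=> [Rw i|H].
    by have := coef_map (meval (fun i => w 0 i)) Rm (m.-1 - i); rewrite Rw coef0.
  apply/polyP => j; rewrite coef_map coef0 /=.
  have [jm|mj] := ltnP j m; last by rewrite nth_default ?meval0 // (leq_trans sR).
  have im : (m.-1 - j < size (iota m.+1 m))%N by rewrite size_iota; lia.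
  have := H (Ordinal im); rewrite /= subKn //; lia.
exists (fun i => Rm`_(m.-1 - i)); split.
- move=> i; rewrite nth_iota ?szi //.
  have := (bihomogP _ _).1 hR (m.-1 - i)%N; have im := szi i.
  rewrite (_ : (m.-1 - i <= 2 * m)%N); last by lia.
  by rewrite (_ : (2 * m - (m.-1 - i) = m.+1 + i)%N) //; lia.
- by move=> w w0; rewrite Zw // Zc.
move=> w w0 /(Zw w w0) Rw.
have onto (i : 'I_(size (iota m.+1 m))) : exists u,
    map_poly (fun c => dev c w u) Rm = 'X^(m.-1 - i).
  by apply: (jacobian_onto pi0 s0 PBR sR sB Bm fr smooth w0 Rw); have := szi i; lia.
have /choice[u uE] := onto.
apply/row_freeP; exists (\matrix_(j, i) u i 0 j).
apply/matrixP => i i'; rewrite !mxE.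
transitivity (dev Rm`_(m.-1 - i) w (u i')).
  by apply: eq_bigr => j _; rewrite !mxE.
rewrite -(coef_map_id0 _ _ (der0 (dev_derivation w (u i')))).
rewrite uE coefXn; congr (_%:R); congr nat_of_bool.
apply/eqP/eqP => [|->//] E; apply/val_inj; have := szi i; have := szi i'.
by move: E => /=; lia.
Qed.
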